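(* Every infinitely-exchangeable randomized policy is in $L_{\mathrm{CO,SYM}}$, i.e. $L_{\mathrm{EX}}\subseteq L_{\mathrm{CO,SYM}}$. Explicitly: for any $P_\pi\in L_{\mathrm{EX}}$ there exists a $[0,1]$-valued random variable $Z$, with distribution $\eta\in\mathcal P([0,1])$, and a conditional law $\tilde P_\pi(\cdot\,|\,z)$ (a stochastic kernel from $[0,1]$ to the common policy space $\Gamma^i$, the same for all $i$, so that $\tilde P_\pi(\cdot|z)\in\mathcal P(\Gamma^i)$ for every fixed $z$) such that for any $A_i\in\mathcal B(\Gamma^i)$, $i\in\mathbb N$, $$P_\pi(\gamma^1\in A_1,\gamma^2\in A_2,\dots)=\int_{[0,1]}\prod_{i\in\mathbb N}\tilde P_\pi(\gamma^i\in A_i\,|\,z)\,\eta(dz).$$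
   Context: Decision makers (DMs) are indexed by $i\in\mathbb N$. All DMs have the same action space $\mathbb U\subseteq\mathbb R^n$ and the same observation space $\mathbb Y\subseteq\mathbb R^m$, both standard Borel. $\mathcal P(\cdot)$ denotes the space of Borel probability measures (with the weak convergence topology) and $\mathcal B(\cdot)$ the Borel $\sigma$-field. Policy space. Let $Q^i=Q$ be a reference probability measure on $\mathbb Y$. The set $\Gamma^i$ of (relaxed) policies of DM $i$ is identified with $$\mathcal R^i=\Big\{P\in\mathcal P(\mathbb U\times\mathbb Y)\ :\ P(B)=\int_B\Pi(du|y)\,Q(dy)\ \ \forall B\in\mathcal B(\mathbb U\times\mathbb Y),\ \Pi\text{ a stochastic kernel from }\mathbb Y\text{ to }\mathbb U\Big\},$$ with the weak convergence topology: $\gamma^i_n\to\gamma^i$ iff $\gamma^i_n(du|y)Q(dy)\to\gamma^i(du|y)Q(dy)$ weakly. The spaces $\Gamma^i$ are all copies of one and the same space. Let $\Gamma=\prod_{i\in\mathbb N}\Gamma^i$ and $L=\mathcal P(\Gamma)$ (the randomized policies). $L_{\mathrm{EX}}$ is the set of $P_\pi\in L$ such that for all $A_i\in\mathcal B(\Gamma^i)$, all $N\in\mathbb N$ and all permutations $\sigma$ of $\{1,\dots,N\}$: $P_\pi(\gamma^1\in A_1,\dots,\gamma^N\in A_N)=P_\pi(\gamma^{\sigma(1)}\in A_1,\dots,\gamma^{\sigma(N)}\in A_N)$. $L_{\mathrm{CO,SYM}}$ is the set of $P_\pi\in L$ for which there are $\eta\in\mathcal P([0,1])$ and a kernel $\tilde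 P_\pi(\cdot|z)$ from $[0,1]$ to the common policy space with $P_\pi(\gamma^1\in A_1,\gamma^2\in A_2,\dots)=\int_{[0,1]}\prod_{i\in\mathbb N}\tilde P_\pi(\gamma^i\in A_i|z)\,\eta(dz)$ for all $A_i\in\mathcal B(\Gamma^i)$. *)

(* Defs.v *)
From HB Require Import structures.
From mathcomp Require Import all_boot all_order all_algebra all_fingroup.
From mathcomp Require Import all_classical all_reals all_analysis.
Import Order.TTheory GRing.Theory Num.Theory.
Import numFieldNormedType.Exports.

Set Implicit Arguments.
Unset Strict Implicit.
Unset Printing Implicit Defensive.

Local Open Scope classical_set_scope.
Local Open Scope ring_scope.

HB.instance Definition _ (T1 T2 : ptopologicalType) :=
  Pointed.on (T1 * T2)%type.

Definition borel (T : ptopologicalType) := g_sigma_algebraType (@open T).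
HB.instance Definition _ (T : ptopologicalType) :=
  Measurable.on (borel T).

Lemma measurable_continuous (T1 T2 : ptopologicalType) (f : T1 -> T2) :
  continuous f -> measurable_fun [set: borel T1] (f : borel T1 -> borel T2).
Proof.
move=> /continuousP cf.
apply: (@measurability _ _ (borel T1) (borel T2) setT f (@open T2)) => //.
move=> _ [B oB <-]; rewrite setTI.
by apply: sub_sigma_algebra; exact: cf.
Qed.

Section weak_convergence.
Context (R : realType) (T : ptopologicalType).

Definition bounded_continuous : set (T -> R) :=
  [set f | continuous f /\ exists M : R, forall x, `|f x| <= M].

Definition integral_against (mu : probability (borel T) R) :
    {ptws set_type bounded_continuous -> R} :=
  fun f => \int[mu]_x (set_val f x).

(* Elements of [probability] are functions on all subsets, so distinct
   elements may agree on every Borel set.  Such elements are topologically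
   indistinguishable, hence lie in the same Borel sets. *)
Definition prob := initial_topology integral_against.
HB.instance Definition _ := Topological.on prob.
HB.instance Definition _ := isPointed.Build prob (point : probability (borel T) R).

End weak_convergence.

(* Measurable types of the library are inhabited, whence [bs_nonempty]. When U
   or Y is empty there is no policy at all (or no reference measure). *)
Record borel_subset (R : realType) (n : nat) := BorelSubset {
  bs_set : set 'rV[R]_n ;
  bs_borel : measurable (bs_set : set (borel 'rV[R]_n)) ;
  bs_nonempty : bs_set !=set0 }.

Section space_of.
Context (R : realType) (n : nat) (S : borel_subset R n).

Definition space_of := set_type (bs_set S).
HB.instance Definition _ := Topological.on space_of.

Lemma space_of_inhabited : inhabited space_of.
Proof. by have [x Sx] := bs_nonempty S; split; exists x; exact: mem_set. Qed.

HB.instance Definition _ := isPointed.Build space_of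
  (inhabited_witness space_of_inhabited).

End space_of.

Section unit_interval.
Context (R : realType).

Definition unit_interval := set_type `[0%R, 1%R : R]%classic.
HB.instance Definition _ := Topological.on unit_interval.

Lemma unit_interval0 : (0 : R) \in `[0%R, 1%R : R]%classic.
Proof. by apply: mem_set; rewrite /= in_itv/= lexx ler01. Qed.

HB.instance Definition _ := isPointed.Build unit_interval
  (exist _ 0 unit_interval0).

End unit_interval.
Arguments unit_interval : clear implicits.

Section policies.
Context (R : realType) (U Y : ptopologicalType).
Variable Q : probability (borel Y) R.

Definition policy_set : set (prob R (U * Y)%type) :=
  [set P : probability (borel (U * Y)%type) R |
    exists Pi : R.-pker (borel Y) ~> (borel U),
      forall B : set (borel (U * Y)%type), measurable B ->
        P B = (\int[Q]_y Pi y (ysection B y))%E].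

Definition policy := set_type policy_set.
HB.instance Definition _ := Topological.on policy.

Lemma policy_inhabited : inhabited policy.
Proof.
pose f : borel Y -> borel (U * Y)%type := fun y => (point, y).
have mf : measurable_fun setT f.
  apply: (@measurable_continuous Y (U * Y)%type) => y.
  by apply: cvg_pair => //; exact: cvg_cst.
pose F := [the {mfun borel Y >-> borel (U * Y)%type} of mfun_Sub (mem_set mf)].
pose P := [the probability _ R of distribution Q F].
split; exists (P : prob R (U * Y)%type); apply: mem_set => /=.
pose Pi : R.-pker (borel Y) ~> (borel U) :=
  kprobability (measurable_cst (dirac (point : borel U) : pprobability _ R)).
exists Pi => B mB.
rewrite /P /= /distribution /pushforward /Pi /=.
have mfB : measurable (f @^-1` B).
  by rewrite -[X in measurable X]setTI; exact: (mf measurableT).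
transitivity (\int[Q]_y (\1_(f @^-1` B) y)%:E)%E.
  by rewrite integral_indic// setIT.
by apply: eq_integral => y _; rewrite /kprobability/= diracE indicE mem_ysection.
Qed.

HB.instance Definition _ := isPointed.Build policy
  (inhabited_witness policy_inhabited).

Definition policy_profile := prod_topology (fun _ : nat => policy).
HB.instance Definition _ := Topological.on policy_profile.
HB.instance Definition _ := isPointed.Build policy_profile (fun=> point).

Definition randomized_policy := probability (borel policy_profile) R.

Definition L_EX : set randomized_policy :=
  [set P : randomized_policy | forall (N : nat) (s : 'S_N) (A : 'I_N -> set (borel policy)),
    (forall i, measurable (A i)) ->
    P [set g : policy_profile | forall i : 'I_N, A i (g i)] =
    P [set g : policy_profile | forall i : 'I_N, A i (g (s i))]].

(* The partial products are nonincreasing in [0, 1], so that the limit, i.e.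
   the infinite product, always exists. *)
Definition mixture (P : randomized_policy)
    (eta : probability (borel (unit_interval R)) R)
    (K : R.-pker (borel (unit_interval R)) ~> (borel policy)) :=
  forall A : nat -> set (borel policy), (forall i, measurable (A i)) ->
    P [set g : policy_profile | forall i, A i (g i)] =
    (\int[eta]_z limn (fun n => \prod_(i < n) K z (A i)))%E.

Definition L_CO_SYM : set randomized_policy :=
  [set P : randomized_policy |
    exists (eta : probability (borel (unit_interval R)) R)
      (K : R.-pker (borel (unit_interval R)) ~> (borel policy)),
    mixture P eta K].

End policies.
Arguments L_EX {R} U {Y} Q.
Arguments L_CO_SYM {R} U {Y} Q.

(* Main.v *)
(* Call a measurable space X coded when there are measurable maps
   X -> R -> X whose composite preserves membership in every measurable set.
   On a coded space, let F_A be random variables, indexed by the measurable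
   sets A, which are almost surely finitely additive in A and whose means form
   a probability.  Their values on the preimages of rational half-lines are
   almost surely a distribution function, so that F is almost surely given by
   a universal kernel from R to X evaluated at a real code of this countable
   family of values.

   For an exchangeable sequence xi in a coded space, take for F_A the limiting
   frequency of A along the subsequence 4 ^ j: empirical means over two sets
   of n and m indices are at distance at most (1 / n + 1 / m) ^ (1 / 2) in L^2,
   which gives both almost sure convergence and independence of the set of
   indices.  Averaging over disjoint blocks of indices then yields
   P (xi_1 in A_1, ..., xi_N in A_N) = E (F_{A_1} ... F_{A_N}).

   The space of policies is coded.  Its weak topology has a countable base,
   since U * Y has a countable base of cozero sets, so that a policy is coded
   by its values on countably many sets; conversely a probability measure on
   U * Y is a policy as soon as its second marginal is Q, by the same
   regularisation of F_A, now applied to Radon-Nikodym densities. *)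

(* The obstacle is countable additivity: the limiting frequencies are additive only outside null
   sets that depend on the sets involved, and there are uncountably many sets. On the real line a
   probability is determined by countably many numbers subject to countably many conditions, so a
   single null set suffices there. A coding carries this over to [X]; no metric or completeness of
   the space of policies is ever established, and policies that no Borel set separates do no harm.
   The resulting kernel agrees with F_A outside a null set that still depends on A. This is enough,
   because a cylinder involves only countably many sets A_i. Second moments take the place of
   conditional expectations given a tail field: the powers 4 ^ j are chosen so that the L^1 errors,
   of order 2 ^ (- j), are summable. The mixing variable is the code of the directing measure, a
   function on the space of profiles itself; it lies in [0, 1] because codes are ternary
   expansions. *)
Require Import Defs.
From HB Require Import structures.
From mathcomp Require Import all_boot all_order all_algebra all_fingroup.
From mathcomp Require Import all_classical all_reals all_analysis.
From mathcomp Require Import measurable_realfun.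
From mathcomp Require Import ring lra.

Import Order.TTheory GRing.Theory Num.Theory.
Import numFieldNormedType.Exports.

Set Implicit Arguments.
Unset Strict Implicit.
Unset Printing Implicit Defensive.

Local Open Scope classical_set_scope.
Local Open Scope ring_scope.

(** * Coding sequences of real numbers by a real number *)

Section real_codes.
Context {R : realType}.

(* Only the digits 0 and 2 occur, so that the first digit is recovered by a
   comparison with 1 / 2. *)
Fixpoint ternary_sum n (b : nat -> bool) : R :=
  if n is n'.+1 then (2 * (b 0%N)%:R + ternary_sum n' (b \o succn)) / 3 else 0.

Lemma ternary_sum_ge0 n b : 0 <= ternary_sum n b.
Proof.
elim: n b => //= n IH b; have := IH (b \o succn).
by case: (b 0%N) => /= ?; lra.
Qed.

Lemma ternary_sum_le1 n b : ternary_sum n b <= 1.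
Proof.
elim: n b => [b|n IH b] /=; first exact: ler01.
by have := IH (b \o succn); case: (b 0%N) => /= ?; lra.
Qed.

Lemma ternary_sum_nd b : nondecreasing_seq (ternary_sum ^~ b).
Proof.
apply/nondecreasing_seqP => n; elim: n b => [b|n IH b].
  exact: ternary_sum_ge0.
rewrite [leLHS]/= [leRHS]/= ler_pM2r ?invr_gt0// lerD2l.
exact: (IH (b \o succn)).
Qed.

Lemma is_cvg_ternary_sum b : cvgn (ternary_sum ^~ b).
Proof.
apply: nondecreasing_is_cvgn; first exact: ternary_sum_nd.
by exists 1 => _ [n _ <-]; exact: ternary_sum_le1.
Qed.

Definition ternary (b : nat -> bool) : R := limn (ternary_sum ^~ b).

Lemma ternary_itv b : 0 <= ternary b <= 1.
Proof.
apply/andP; split.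
  apply: limr_ge; first exact: is_cvg_ternary_sum.
  by apply: nearW => n; exact: ternary_sum_ge0.
apply: limr_le; first exact: is_cvg_ternary_sum.
by apply: nearW => n; exact: ternary_sum_le1.
Qed.

Lemma ternaryS b : ternary b = (2 * (b 0%N)%:R + ternary (b \o succn)) / 3.
Proof.
apply/cvg_lim => //; rewrite -(cvg_shiftS _) /=.
apply: cvgM; last exact: cvg_cst.
apply: cvgD; first exact: cvg_cst.
exact: is_cvg_ternary_sum.
Qed.

Definition ternary_shift (z : R) : R := 3 * z - 2 * (2^-1 < z)%R%:R.

Definition ternary_digit k (z : R) : bool := 2^-1 < iter k ternary_shift z.

Lemma ternary_digitK k b : ternary_digit k (ternary b) = b k.
Proof.
have head b' : (2^-1 < ternary b') = b' 0%N.
  rewrite ternaryS; have /andP[] := ternary_itv (b' \o succn).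
  case: (b' 0%N) => /= ? ?; apply/idP => //; first by lra.
  by apply/negP; rewrite -leNgt; lra.
have shiftE b' : ternary_shift (ternary b') = ternary (b' \o succn).
  by rewrite /ternary_shift head (ternaryS b'); field.
rewrite /ternary_digit.
suff -> : iter k ternary_shift (ternary b) = ternary (fun j => b (k + j)%N).
  by rewrite head addn0.
elim: k => [//|k IH]; rewrite iterS IH shiftE; congr ternary.
by apply/funext => j /=; rewrite addnS addSn.
Qed.

Lemma measurable_ternary_shift : measurable_fun setT ternary_shift.
Proof.
apply: measurable_funB; first exact: measurable_funM.
apply: measurable_funM => //.
rewrite (_ : (fun _ => _) = \1_([set z : R | 2^-1 < z])); last first.
  by apply/funext => z; rewrite indicE mem_setE.
apply: measurable_indic; rewrite -[X in measurable X]setTI.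
exact: measurable_fun_ltr.
Qed.

Lemma measurable_ternary_digit k : measurable_fun setT (ternary_digit k).
Proof.
apply: measurable_fun_ltr; first exact: measurable_cst.
elim: k => [|k IH]; first exact: measurable_id.
exact: (measurableT_comp measurable_ternary_shift IH).
Qed.

Lemma measurable_ternary d (X : measurableType d) (b : X -> nat -> bool) :
  (forall k, measurable_fun setT (b ^~ k)) ->
  measurable_fun setT (fun x => ternary (b x)).
Proof.
move=> mb; apply: (measurable_fun_cvg (h := fun n x => ternary_sum n (b x))).
  move=> n; elim: n b mb => [b mb|n IH b mb] /=; first exact: measurable_cst.
  apply: measurable_funM => //; apply: measurable_funD.
    apply: measurable_funM => //.
    rewrite (_ : (fun _ => _) = \1_[set x | b x 0%N]).
      by apply: measurable_indic; rewrite -[X in measurable X]setTI; exact: mb.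
    by apply/funext => z; rewrite indicE mem_setE.
  by apply: IH => k; exact: mb.
by move=> x _; exact: is_cvg_ternary_sum.
Qed.

(** Indices that decode to no rational repeat the value 0, which is harmless: only density of the
    range is used. *)
Definition rat_seq (k : nat) : R := ratr (odflt 0 (unpickle k)).

Lemma rat_seq_dense (a b : R) : a < b -> exists k, a < rat_seq k < b.
Proof.
move=> /rat_in_itvoo[q]; rewrite in_itv/= => qab.
by exists (pickle q); rewrite /rat_seq pickleK.
Qed.

(* [x k] is recovered as the supremum of the rationals below it. *)
Definition encode (x : nat -> R) : R :=
  ternary (fun i => let kj := odflt (0, 0)%N (unpickle i) in
    rat_seq kj.2 < x kj.1).

(** A digit 0 contributes -oo, the neutral element of the supremum. For a real that encodes no
    sequence the supremum may be infinite, and [fine] then returns 0, which keeps [decode] total and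
    measurable. *)
Definition decode (z : R) (k : nat) : R :=
  fine (esups (fun j => if ternary_digit (pickle (k, j)) z then (rat_seq j)%:E
                        else -oo%E) 0).

Lemma encode_itv x : 0 <= encode x <= 1.
Proof. exact: ternary_itv. Qed.

Lemma encodeK x k : decode (encode x) k = x k.
Proof.
rewrite /decode (_ : (fun _ => _) =
  fun j => if rat_seq j < x k then (rat_seq j)%:E else -oo%E); last first.
  by apply/funext => j; rewrite ternary_digitK pickleK.
suff -> : esups (fun j => if rat_seq j < x k then (rat_seq j)%:E
    else -oo%E) 0 = (x k)%:E by [].
apply/eqP; rewrite eq_le; apply/andP; split.
  apply: ge_ereal_sup => _ [j _ <-].
  by case: ifPn => [/ltW|] //; rewrite ?lee_fin// leNye.
apply/lee_addgt0Pr => e e0.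
have [|j /andP[j1 j2]] := @rat_seq_dense (x k - e) (x k); first by lra.
apply: (@le_trans _ _ ((rat_seq j)%:E + e%:E)%E).
  by rewrite -EFinD lee_fin; lra.
by apply: leeD => //; apply: ereal_sup_ubound; exists j => //=; rewrite j2.
Qed.

Lemma measurable_decode k : measurable_fun setT (decode ^~ k).
Proof.
apply: measurableT_comp; first exact: fine_measurable.
apply: measurable_fun_esups => j; apply: measurable_fun_ifT.
- exact: measurable_ternary_digit.
- exact: measurable_cst.
- exact: measurable_cst.
Qed.

Lemma measurable_encode d (X : measurableType d) (x : X -> nat -> R) :
  (forall k, measurable_fun setT (x ^~ k)) ->
  measurable_fun setT (fun t => encode (x t)).
Proof.
move=> mx; apply: measurable_ternary => i /=.
by apply: measurable_fun_ltr => //; exact: mx.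
Qed.

End real_codes.

(** * Laws of measurable maps and the Dynkin argument for probabilities *)

Section laws.
Context {R : realType}.

Lemma measurable_ltr_set d (X : measurableType d) (f g : X -> R) :
  measurable_fun setT f -> measurable_fun setT g ->
  measurable [set t | f t < g t].
Proof.
move=> mf mg; rewrite -[X in measurable X]setTI.
by have := measurable_fun_ltr mf mg; apply=> //; exact: measurableT.
Qed.

Lemma measurable_ler_set d (X : measurableType d) (f g : X -> R) :
  measurable_fun setT f -> measurable_fun setT g ->
  measurable [set t | f t <= g t].
Proof.
move=> mf mg; rewrite -[X in measurable X]setTI.
by have := measurable_fun_ler mf mg; apply=> //; exact: measurableT.
Qed.

Definition law d d' (X : measurableType d) (Y : measurableType d')
    (P : probability X R) (f : X -> Y) (mf : measurable_fun setT f) :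
    probability Y R :=
  distribution P [the {mfun X >-> Y} of mfun_Sub (mem_set mf)].

(** The sets with a measurable evaluation form a Dynkin system, so a generating family stable under
    intersection suffices. *)
Lemma probability_familyP d d' (X : measurableType d) (Y : measurableType d')
    (G : set (set Y)) (P : X -> probability Y R) :
  @measurable _ Y = <<s G >> -> setI_closed G ->
  (forall A, G A -> measurable_fun setT (fun x => P x A)) ->
  forall A, measurable A -> measurable_fun setT (fun x => P x A).
Proof.
move=> GE GI mG A mA.
apply: (@dynkin_induction _ Y G
  (fun A => measurable_fun setT (fun x => P x A)) GE GI); last by rewrite -GE.
- rewrite (_ : (fun x : X => P x setT) = cst 1%E) => [//|].
  by apply/funext => x; rewrite probability_setT.
- exact: mG.
- move=> S mS mPS.
  rewrite (_ : (fun _ => _) = (fun x => 1 - P x S)%E); last first.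
    by apply/funext => x; rewrite probability_setC.
  by apply: emeasurable_funB => //; exact: measurable_cst.
- move=> F mF tF mPF.
  rewrite (_ : (fun _ => _) =
    (fun x => \sum_(0 <= k <oo) P x (F k))%E); last first.
    apply/funext => x; rewrite measure_semi_bigcup//.
    exact: bigcup_measurable.
  by apply: ge0_emeasurable_sum.
Qed.

Lemma probability_uniqueness d (Y : measurableType d) (G : set (set Y))
    (P Q : probability Y R) :
  @measurable _ Y = <<s G >> -> setI_closed G ->
  (forall A, G A -> P A = Q A) -> forall A, measurable A -> P A = Q A.
Proof.
move=> GE GI PQ A mA.
apply: (@dynkin_induction _ Y G (fun A => P A = Q A) GE GI); last by rewrite -GE.
- by rewrite !probability_setT.
- exact: PQ.
- by move=> S mS PQS; rewrite !probability_setC// PQS.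
- move=> F mF tF PQF.
  rewrite !measure_semi_bigcup//; try exact: bigcup_measurable.
  by apply: eq_eseriesr => k _; exact: PQF.
Qed.

End laws.

(** * Distribution functions restricted to the rationals *)

Section cdf_codes.
Context {R : realType}.

Definition halfline (k : nat) : set R := `]-oo, rat_seq k]%classic.

Lemma measurable_halfline k : measurable (halfline k).
Proof. exact: measurable_itv. Qed.

Lemma halflineE : @measurable _ (measurableTypeR R) = <<s range halfline >>.
Proof.
rewrite [LHS]RGenOInfty.measurableE; apply/seteqP; split.
  apply: smallest_sub; first exact: smallest_sigma_algebra.
  move=> _ [x ->].
  pose G := g_sigma_algebraType (range halfline).
  rewrite (_ : `]x, +oo[%classic =
      \bigcup_(k in [set k | x < rat_seq k]) (~` halfline k)); last first.
    apply/seteqP; split => y /=; rewrite in_itv/= andbT.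
      move=> /rat_seq_dense[k /andP[xk ky]]; exists k => //=.
      by rewrite /halfline/= in_itv/=; apply/negP; rewrite -ltNge.
    move=> [k /= xk]; rewrite /halfline/= in_itv/= => /negP; rewrite -ltNge.
    exact: lt_trans.
  apply: (@bigcup_measurable _ G) => k _; apply: (@measurableC _ G).
  by apply: sub_sigma_algebra; exists k.
apply: smallest_sub; first exact: smallest_sigma_algebra.
move=> _ [k _ <-]; rewrite -RGenOInfty.measurableE.
exact: measurable_halfline.
Qed.

Lemma halflineI : setI_closed (range halfline).
Proof.
move=> _ _ [i _ <-] [j _ <-].
wlog ij : i j / rat_seq i <= rat_seq j :> R.
  move=> H; have [/H//|/ltW/H] := leP (rat_seq i : R) (rat_seq j).
  by rewrite setIC.
exists i => //; rewrite setIidl// /halfline; apply: subset_itvl => //=.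
Qed.

Lemma halflineS i j : rat_seq i <= rat_seq j :> R -> halfline i `<=` halfline j.
Proof. by move=> ij; exact: subset_itvl. Qed.

(** The traces on the rationals of distribution functions. Every clause is a countable combination
    of inequalities between coordinates, which makes the set of such sequences measurable.
    Monotonicity, stated through the values [rat_seq], also forces equal entries at repeated
    rationals. *)
Record cdf_seq (x : nat -> R) : Prop := CdfSeq {
  cdf_seq_nd : forall i j, (rat_seq i <= rat_seq j :> R) -> x i <= x j ;
  cdf_seq_itv : forall k, 0 <= x k <= 1 ;
  cdf_seq0 : forall n, exists k, x k < n.+1%:R^-1 ;
  cdf_seq1 : forall n, exists k, 1 - n.+1%:R^-1 < x k ;
  cdf_seq_rc : forall k n, exists j, rat_seq k < rat_seq j :> R /\
    x j < x k + n.+1%:R^-1 }.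

Lemma invS_lt (e : R) : 0 < e -> exists n, n.+1%:R^-1 < e.
Proof.
move=> e0; exists (Num.truncn e^-1).
rewrite invf_plt ?posrE//; exact: truncnS_gt.
Qed.

Section cdf_of_seq.
Variable x : nat -> R.
Hypothesis cx : cdf_seq x.

(** Taking the infimum over strictly larger rationals makes [F] right continuous for any [x]; the
    clause [cdf_seq_rc] is what gives back [x] at the rationals ([FE]). *)
Let F (t : R) : R := inf [set x k | k in [set k | t < rat_seq k]].

Let F_has_inf (t : R) : has_inf [set x k | k in [set k | t < rat_seq k]].
Proof.
split; last by exists 0 => _ [k _ <-]; case/andP: (cdf_seq_itv cx k).
have [|k /andP[tk _]] := @rat_seq_dense R t (t + 1); first by rewrite ltrDl.
by exists (x k), k.
Qed.

Let F_le (t : R) k : t < rat_seq k -> F t <= x k.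
Proof. by move=> tk; apply: ge_inf; [case: (F_has_inf t)|exists k]. Qed.

Let F_ge (t a : R) : (forall k, t < rat_seq k -> a <= x k) -> a <= F t.
Proof.
move=> ha; apply: lb_le_inf; first by case: (F_has_inf t).
by move=> _ [k /= tk <-]; exact: ha.
Qed.

Let FE k : F (rat_seq k) = x k.
Proof.
apply/eqP; rewrite eq_le; apply/andP; split.
  apply/ler_addgt0Pr => e /invS_lt[n ne].
  have [j [kj xj]] := cdf_seq_rc cx k n.
  by rewrite (le_trans (F_le kj))// (le_trans (ltW xj))// lerD2l ltW.
by apply: F_ge => j kj; apply: (cdf_seq_nd cx); exact: ltW.
Qed.

Let F_nd : nondecreasing F.
Proof. by move=> s t st; apply: F_ge => k tk; exact/F_le/(le_lt_trans st). Qed.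

Let F_rc : right_continuous F.
Proof.
move=> t; apply/(@cvgrPdist_le _ R^o) => e e0.
have [_ [k /= tk <-] xk] := inf_adherent e0 (F_has_inf t).
near=> s; rewrite distrC ger0_norm ?subr_ge0; last exact: F_nd.
rewrite lerBlDl (le_trans _ (ltW xk))//; apply: F_le.
by near: s; exact: nbhs_right_lt.
Unshelve. all: by end_near. Qed.

Let F_Ny0 : F @ -oo --> (0 : R).
Proof.
apply/(@cvgrPdist_le _ R^o) => e /invS_lt[n ne].
have [k xk] := cdf_seq0 cx n.
near=> s; rewrite sub0r normrN ger0_norm; last first.
  by apply: F_ge => j _; case/andP: (cdf_seq_itv cx j).
apply: (le_trans (@F_le s k _)); last exact/ltW/(lt_trans xk).
by near: s; apply: nbhs_ninfty_lt; exact: num_real.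
Unshelve. all: by end_near. Qed.

Let F_y1 : F @ +oo --> (1 : R).
Proof.
apply/(@cvgrPdist_le _ R^o) => e /invS_lt[n ne].
have [k xk] := cdf_seq1 cx n.
near=> s; rewrite ger0_norm; last first.
  rewrite subr_ge0; have [|j /andP[sj _]] := @rat_seq_dense R s (s + 1).
    by lra.
  by apply: (le_trans (F_le sj)); case/andP: (cdf_seq_itv cx j).
suff xF : x k <= F s.
  rewrite lerBlDl -lerBlDr (le_trans _ xF)// (le_trans _ (ltW xk))//.
  by rewrite lerD2l lerN2 ltW.
rewrite -FE; apply: F_nd.
by near: s; apply: nbhs_pinfty_ge; exact: num_real.
Unshelve. all: by end_near. Qed.

#[local] HB.instance Definition _ := isCumulative.Build R _ R F F_nd F_rc.
#[local] HB.instance Definition _ := isCumulativeBounded.Build R 0 1 F F_Ny0 F_y1.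

Lemma cdf_seq_probability :
  exists mu : probability (measurableTypeR R) R,
    forall k, mu (halfline k) = (x k)%:E.
Proof.
exists [the probability _ _ of lebesgue_stieltjes_measure F] => k.
rewrite -FE -(cdf_lebesgue_stieltjes_id F (rat_seq k)).
by rewrite /cdf /distribution /pushforward preimage_id.
Qed.

End cdf_of_seq.

Section seq_of_probability.
Variable mu : probability (measurableTypeR R) R.
Local Open Scope measure_display_scope.

(** Distribution functions are attached to random variables, so [mu] is read as the law of the
    identity. *)
Let idR : measurableTypeR R -> R := idfun.
#[local] HB.instance Definition _ :=
  @isMeasurableFun.Build _ _ _ _ idR (@measurable_id _ _ setT).

Let G t := cdf (idR : {RV mu >-> R}) t.

Let GE k : G (rat_seq k) = mu (halfline k).
Proof. by rewrite /G /cdf /distribution /pushforward preimage_id. Qed.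

Let G_fin t : G t \is a fin_num. Proof. exact: fin_num_measure. Qed.

Lemma probability_cdf_seq : cdf_seq (fun k => fine (mu (halfline k))).
Proof.
have fG k : fine (mu (halfline k)) = fine (G (rat_seq k)) by rewrite GE.
split => [i j ij|k|n|n|k n].
- by rewrite !fG fine_le// cdf_nondecreasing.
- rewrite -!lee_fin fineK ?fin_num_measure//; last exact: measurable_halfline.
  by rewrite measure_ge0 probability_le1//; exact: measurable_halfline.
- have /fine_cvg/(@cvgrPdist_lt _ R^o)/(_ n.+1%:R^-1) :=
    cvg_cdfNy0 (idR : {RV mu >-> R}).
  rewrite invr_gt0 ltr0n => /(_ isT) [M [Mr hM]].
  have [|k /andP[_ kM]] := @rat_seq_dense R (M - 1) M; first by lra.
  exists k; have := hM _ kM; rewrite /= sub0r normrN fG => /le_lt_trans; apply.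
  exact: ler_norm.
- have /fine_cvg/(@cvgrPdist_lt _ R^o)/(_ n.+1%:R^-1) :=
    cvg_cdfy1 (idR : {RV mu >-> R}).
  rewrite invr_gt0 ltr0n => /(_ isT) [M [Mr hM]].
  have [|k /andP[Mk _]] := @rat_seq_dense R M (M + 1); first by lra.
  exists k; have := hM _ Mk; rewrite /= ltr_distlC fG => /andP[+ _].
  exact.
- have := @cdf_right_continuous _ _ _ _ (idR : {RV mu >-> R}) (rat_seq k).
  rewrite -/(G _) -(fineK (G_fin _)).
  move=> /fine_cvg/(@cvgrPdist_lt _ R^o)/(_ n.+1%:R^-1).
  rewrite invr_gt0 ltr0n => /(_ isT) [e /= e0 he].
  have [|j /andP[kj je]] := @rat_seq_dense R (rat_seq k) (rat_seq k + e).
    by rewrite ltrDl.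
  exists j; split => //.
  have := he (rat_seq j); rewrite /= ltr0_norm ?subr_lt0// opprB ltrBlDl.
  move=> /(_ je kj); rewrite ltr_distlC !fG => /andP[_].
  by rewrite addrC.
Qed.

End seq_of_probability.

End cdf_codes.

(** * Coded spaces and the universal kernel *)

Section codings.
Context {R : realType}.

(** [R] and [measurableTypeR R] have the same Borel sets but different structures; this identity and
    the next one move laws between them. *)
Lemma measurable_id_RT : measurable_fun setT (idfun : measurableTypeR R -> R).
Proof. exact: (@measurable_id _ _ setT). Qed.

Lemma measurable_id_TR : measurable_fun setT (idfun : R -> measurableTypeR R).
Proof. exact: (@measurable_id _ _ setT). Qed.

Lemma halflineER : @measurable _ R = <<s range (@halfline R) >>.
Proof. exact: halflineE. Qed.

Lemma cdf_measure_subproof (x : nat -> R) :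
  exists mu : probability R R,
    cdf_seq x -> forall k, mu (halfline k) = (x k)%:E.
Proof.
have [cx|ncx] := pselect (cdf_seq x).
  have [mu muE] := cdf_seq_probability cx.
  by exists (law mu measurable_id_RT) => _ k; rewrite -muE.
by exists [the probability R R of dirac (0 : R)].
Qed.

(** The second case split is deliberate: [cdf_measure_subproof] says nothing outside [cdf_seq], and
    an unspecified choice there could destroy measurability in [x]. *)
Definition cdf_measure (x : nat -> R) : probability R R :=
  if pselect (cdf_seq x) then sval (cid (cdf_measure_subproof x))
  else [the probability R R of dirac (0 : R)].

Lemma cdf_measureE x k :
  cdf_seq x -> cdf_measure x (halfline k) = (x k)%:E.
Proof.
move=> cx; rewrite /cdf_measure; case: pselect => //= _.
by case: cid => mu /= /(_ cx).
Qed.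

Lemma cdf_seq_halfline (mu : probability R R) :
  cdf_seq (fun k => fine (mu (halfline k))).
Proof. exact: (probability_cdf_seq (law mu measurable_id_TR)). Qed.

Section measurability.
Context d (X : measurableType d) (x : X -> nat -> R).
Hypothesis mx : forall k, measurable_fun setT (x ^~ k).

Lemma measurable_cdf_seq : measurable [set t | cdf_seq (x t)].
Proof.
rewrite (_ : [set _ | _] =
  (\bigcap_i \bigcap_j
     [set t | (rat_seq i <= rat_seq j :> R) -> x t i <= x t j]) `&`
  (\bigcap_k ([set t | 0 <= x t k] `&` [set t | x t k <= 1])) `&`
  (\bigcap_n \bigcup_k [set t | x t k < n.+1%:R^-1]) `&`
  (\bigcap_n \bigcup_k [set t | 1 - n.+1%:R^-1 < x t k]) `&`
  (\bigcap_k \bigcap_n \bigcup_j [set t | rat_seq k < rat_seq j :> R /\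
    x t j < x t k + n.+1%:R^-1])); last first.
  apply/seteqP; split => t /=.
    move=> [c1 c2 c3 c4 c5]; do !split.
    - by move=> i _ j _; exact: c1.
    - by case/andP: (c2 i).
    - by case/andP: (c2 i).
    - by move=> n _; have [k] := c3 n; exists k.
    - by move=> n _; have [k] := c4 n; exists k.
    - by move=> k _ n _; have [j] := c5 k n; exists j.
  move=> [[[[c1 c2] c3] c4] c5]; split.
  - by move=> i j; exact: (c1 i I j I).
  - by move=> k; apply/andP; exact: (c2 k I).
  - by move=> n; have [k _] := c3 n I; exists k.
  - by move=> n; have [k _] := c4 n I; exists k.
  - by move=> k n; have [j _] := c5 k I n I; exists j.
repeat apply: measurableI.
- apply: bigcapT_measurable => i; apply: bigcapT_measurable => j.
  have [ij|ij] := leP (rat_seq i : R) (rat_seq j).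
    rewrite (_ : [set _ | _] = [set t | x t i <= x t j]).
      exact: measurable_ler_set.
    by apply/seteqP; split => t /=; [exact|move=> ? _].
  by rewrite (_ : [set _ | _] = setT)//; apply/seteqP; split.
- apply: bigcapT_measurable => k; apply: measurableI; apply: measurable_ler_set => //;
    exact: measurable_cst.
- apply: bigcapT_measurable => n; apply: bigcupT_measurable => k.
  by apply: measurable_ltr_set => //; exact: measurable_cst.
- apply: bigcapT_measurable => n; apply: bigcupT_measurable => k.
  by apply: measurable_ltr_set => //; exact: measurable_cst.
- apply: bigcapT_measurable => k; apply: bigcapT_measurable => n.
  apply: bigcupT_measurable => j.
  have [kj|kj] := ltP (rat_seq k : R) (rat_seq j).
    rewrite (_ : [set _ | _] = [set t | x t j < x t k + n.+1%:R^-1]).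
      by apply: measurable_ltr_set => //; apply: measurable_funD => //;
        exact: measurable_cst.
    by apply/seteqP; split => t /=; [case|].
  by rewrite (_ : [set _ | _] = set0)//; apply/seteqP; split => t //= [].
Qed.

Lemma measurable_cdf_measure A : measurable A ->
  measurable_fun setT (fun t => cdf_measure (x t) A).
Proof.
move: A; apply: probability_familyP halflineER halflineI _.
move=> _ [k _ <-].
rewrite (_ : (fun _ => _) = (fun t => if `[< cdf_seq (x t) >] then (x t k)%:E
  else \d_(0 : R) (halfline k))); last first.
  apply/funext => t; case: asboolP => [cx|ncx]; first by rewrite cdf_measureE.
  by rewrite /cdf_measure; case: pselect.
apply: measurable_fun_ifT.
- apply: (measurable_fun_bool true).
  rewrite setTI (_ : _ @^-1` _ = [set t | cdf_seq (x t)]).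
    exact: measurable_cdf_seq.
  by apply/seteqP; split => t /= /asboolP.
- exact/measurable_EFinP.
- exact: measurable_cst.
Qed.

End measurability.

(* [uncode \o code] need not be the identity, because the points of a space of
   measures given as set functions are only determined up to
   indistinguishability by measurable sets. *)
Record coding d (X : measurableType d) := Coding {
  code : X -> R ;
  uncode : R -> X ;
  measurable_code : measurable_fun setT code ;
  measurable_uncode : measurable_fun setT uncode ;
  codeK : forall A x, measurable A -> A (uncode (code x)) <-> A x }.

Section universal_kernel.
Context d (X : measurableType d) (c : coding X).

Definition code_halfline k : set X := code c @^-1` halfline k.

Lemma measurable_code_halfline k : measurable (code_halfline k).
Proof.
rewrite -[X in measurable X]setTI.
by apply: measurable_code => //; exact: measurable_halfline.
Qed.

(** Universal because every probability on [X] occurs, as far as measurable sets can tell, at the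
    code of its values on the sets [code_halfline]. A random measure thus becomes this fixed kernel
    at a random real. *)
Definition universal_kernel (z : R) : probability X R :=
  law (cdf_measure (decode z)) (measurable_uncode c).

Lemma measurable_universal_kernel A : measurable A ->
  measurable_fun setT (fun z => universal_kernel z A).
Proof.
move=> mA.
apply: (@measurable_cdf_measure _ _ decode measurable_decode (uncode c @^-1` A)).
by rewrite -[X in measurable X]setTI; exact: measurable_uncode.
Qed.

Lemma preimage_codeK A : measurable A ->
  code c @^-1` (uncode c @^-1` A) = A.
Proof. by move=> mA; apply/seteqP; split => x /=; rewrite codeK. Qed.

Lemma universal_kernel_encode (x : nat -> R) A : measurable A ->
  universal_kernel (encode x) A = cdf_measure x (uncode c @^-1` A).
Proof.
move=> mA; rewrite /universal_kernel /law/= /distribution/= /pushforward/=.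
by congr (cdf_measure _ _); apply/funext => k; rewrite encodeK.
Qed.

Lemma universal_kernelE (mu : probability X R) A : measurable A ->
  universal_kernel (encode (fun k => fine (mu (code_halfline k)))) A = mu A.
Proof.
move=> mA; rewrite universal_kernel_encode//.
have mcA : measurable (uncode c @^-1` A).
  by rewrite -[X in measurable X]setTI; exact: measurable_uncode.
(* Once [A] is written as a preimage under [code], both sides are laws on the real line, where
   half-lines decide equality. *)
rewrite -[in RHS](preimage_codeK mA).
apply: (probability_uniqueness (Q := law mu (measurable_code c))
  halflineER halflineI _ mcA).
move=> _ [k _ <-]; rewrite cdf_measureE.
  by rewrite fineK// fin_num_measure//; exact: measurable_code_halfline.
exact: (cdf_seq_halfline (law mu (measurable_code c))).
Qed.

End universal_kernel.

End codings.
Arguments coding R {d} X.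

(** * Regular versions of random finitely additive probabilities *)

Section random_contents.
Context {R : realType} d (Omega : measurableType d) (P : probability Omega R).
Context d' (X : measurableType d') (M : probability X R).

(** The null sets may depend on the sets involved, and no countable additivity is asked: it is
    inherited from [M] through [rc_integral] and Markov's inequality. *)
Record random_content (F : set X -> Omega -> R) : Prop := RandomContent {
  rc_measurable : forall A, measurable A -> measurable_fun setT (F A) ;
  rc_ge0 : forall A w, measurable A -> 0 <= F A w ;
  rc_setU : forall A B, measurable A -> measurable B -> A `&` B = set0 ->
    \forall w \ae P, F (A `|` B) w = F A w + F B w ;
  rc_setT : \forall w \ae P, F setT w = 1 ;
  rc_integral : forall A, measurable A -> (\int[P]_w (F A w)%:E = M A)%E }.

Variable F : set X -> Omega -> R.
Hypothesis rcF : random_content F.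

Lemma rc_markov (A : set X) (e : R) : measurable A -> 0 < e ->
  (P [set w | (e <= F A w)%R] <= e^-1%:E * M A)%E.
Proof.
move=> mA e0; have mFA := rc_measurable rcF mA.
have mS : measurable [set w | e <= F A w].
  by apply: measurable_ler_set => //; exact: measurable_cst.
rewrite -(rc_integral rcF mA) lee_pdivlMl//.
rewrite -integral_cst//=.
apply: (@le_trans _ _ (\int[P]_(w in [set w | (e <= F A w)%R]) (F A w)%:E)%E).
  apply: ge0_le_integral => //.
  - by move=> w _; rewrite lee_fin ltW.
  - by apply/measurable_EFinP; exact: measurable_funTS.
apply: ge0_subset_integral => //; first exact/measurable_EFinP.
by move=> w _; rewrite lee_fin (rc_ge0 rcF).
Qed.

(** By Markov the event that every [F (A n)] is at least 1 / (m + 1) has probability at most (m + 1)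
    M (A n) for each n, hence probability 0. This is the substitute for continuity at the empty
    set. *)
Lemma rc_small (A : nat -> set X) : (forall n, measurable (A n)) ->
  (forall e : R, 0 < e -> exists n, (M (A n) < e%:E)%E) ->
  \forall w \ae P, forall e, 0 < e -> exists n, F (A n) w < e.
Proof.
move=> mA A0.
suff h m : \forall w \ae P, exists n, F (A n) w < m.+1%:R^-1.
  apply: filterS (ae_foralln h) => w Fw e /invS_lt[m me].
  by have [n ?] := Fw m; exists n; exact: lt_trans me.
have m0 : 0 < m.+1%:R^-1 :> R by rewrite invr_gt0.
have mS k : measurable [set w | m.+1%:R^-1 <= F (A k) w].
  apply: measurable_ler_set; first exact: measurable_cst.
  exact: (rc_measurable rcF).
exists (\bigcap_n [set w | m.+1%:R^-1 <= F (A n) w]); split.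
- exact: bigcapT_measurable.
- apply/eqP; rewrite eq_le measure_ge0 andbT; apply/lee_addgt0Pr => e e0.
  (* The bound e / (m + 1) cancels the factor m + 1 of Markov's inequality. *)
  have [n An] := A0 (m.+1%:R^-1 * e) (mulr_gt0 m0 e0).
  rewrite add0e.
  apply: (@le_trans _ _ (P [set w | m.+1%:R^-1 <= F (A n) w])).
    apply: le_measure; rewrite ?inE//; last exact: bigcap_inf.
    exact: bigcapT_measurable.
  apply: (le_trans (rc_markov (mA n) m0)).
  rewrite lee_pdivrMl ?invr_gt0//; apply/ltW.
  by rewrite -EFinM.
- move=> w /= nw n _ /=; rewrite leNgt; apply/negP => Fn; apply: nw.
  by exists n.
Qed.

Lemma rc_le A B : measurable A -> measurable B -> A `<=` B ->
  \forall w \ae P, F A w <= F B w.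
Proof.
move=> mA mB AB.
have mBA : measurable (B `\` A) by exact: measurableD.
have := rc_setU rcF mA mBA (setDIK _ _).
apply: filterS => w; rewrite setDUK// => ->.
by rewrite lerDl (rc_ge0 rcF).
Qed.

Lemma rc_setC A : measurable A -> \forall w \ae P, F (~` A) w = 1 - F A w.
Proof.
move=> mA; have := rc_setU rcF mA (measurableC mA) (setICr A).
rewrite setUCr; apply: filterS2 (rc_setT rcF) => w -> ->.
by rewrite addrC addKr.
Qed.

Variable c : coding R X.

Let x w k := F (code_halfline c k) w.

Let mh k : measurable (code_halfline c k).
Proof. exact: measurable_code_halfline. Qed.

Let Mfin k : M (code_halfline c k) \is a fin_num.
Proof. exact: fin_num_measure. Qed.

(** The law of [code] under [M] has a distribution function. Its order properties pass to [F] by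
    additivity, and its limit properties by [rc_small], applied to sets whose [M]-measure can be
    made small. *)
Lemma rc_cdf_seq : \forall w \ae P, cdf_seq (x w).
Proof.
have [_ _ M0 M1 Mrc] := cdf_seq_halfline (law M (measurable_code c)).
rewrite -/(code_halfline c) in M0 M1 Mrc.
have le_inv e n : n.+1%:R^-1 < e -> forall k,
    fine (M (code_halfline c k)) < n.+1%:R^-1 -> (M (code_halfline c k) < e%:E)%E.
  by move=> ne k kn; rewrite -(fineK (Mfin k)) lte_fin (lt_trans kn).
have c1 : \forall w \ae P, forall i j,
    rat_seq i <= rat_seq j :> R -> x w i <= x w j.
  apply: ae_foralln => i; apply: ae_foralln => j.
  have [ij|ij] := leP (rat_seq i : R) (rat_seq j); last exact: nearW.
  apply: filterS (rc_le (mh i) (mh j) _) => [w + _//|].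
  exact: preimage_subset (halflineS ij).
have c2 : \forall w \ae P, forall k, x w k <= 1.
  apply: ae_foralln => k; apply: filterS2 (rc_setT rcF) _ => [w <-|].
    exact.
  exact: (rc_le (mh k) measurableT).
have c3 : \forall w \ae P, forall e, 0 < e -> exists k, x w k < e.
  apply: rc_small => // e /invS_lt[n ne]; have [k kn] := M0 n.
  by exists k; exact: le_inv kn.
have c4 : \forall w \ae P, forall e, 0 < e -> exists k, 1 - e < x w k.
  have mC k : measurable (~` code_halfline c k) by exact: measurableC.
  have FC : \forall w \ae P, forall k, F (~` code_halfline c k) w = 1 - x w k.
    by apply: ae_foralln => k; exact: rc_setC.
  apply: filterS2 FC (rc_small mC _) => [w wE h e /h[k]|].
    by rewrite wE => k1; exists k; rewrite ltrBlDr addrC -ltrBlDr.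
  move=> e /invS_lt[n ne]; have [k kn] := M1 n; exists k.
  rewrite probability_setC// -(fineK (Mfin k)) -EFinB lte_fin.
  by apply: lt_trans ne; rewrite ltrBlDr addrC -ltrBlDr.
have c5 : \forall w \ae P, forall k e, 0 < e <= 1 -> exists j,
    rat_seq k < rat_seq j :> R /\ x w j < x w k + e.
  suff h k : \forall w \ae P, forall e, 0 < e <= 1 -> exists j,
    rat_seq k < rat_seq j :> R /\ x w j < x w k + e by exact: ae_foralln.
  (* For a rational not above [rat_seq k] the set is [setT], of frequency 1. A value below [e <= 1]
     therefore forces [rat_seq k < rat_seq j]. *)
  pose A j := if rat_seq k < rat_seq j :> R
              then code_halfline c j `\` code_halfline c k else setT.
  have mA j : measurable (A j).
    by rewrite /A; case: ifPn => _ //; exact: measurableD.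
  have kj j : rat_seq k < rat_seq j :> R ->
      code_halfline c k `<=` code_halfline c j.
    by move=> /ltW/halflineS; exact: preimage_subset.
  have FA : \forall w \ae P, forall j, rat_seq k < rat_seq j :> R ->
      x w j = x w k + F (A j) w.
    apply: ae_foralln => j; rewrite /A.
    case: ifPn => [lt_kj|_]; last exact: nearW.
    have := rc_setU rcF (mh k) (measurableD (mh j) (mh k)) (setDIK _ _).
    by apply: filterS => w; rewrite setDUK; [move=> + _|exact: kj].
  have Asmall : \forall w \ae P, forall e, 0 < e -> exists n, F (A n) w < e.
    apply: rc_small mA _ => e /invS_lt[n ne].
    have [j [lt_kj xj]] := Mrc k n; exists j.
    rewrite /A lt_kj measureD//; last by rewrite ltey_eq Mfin.
    rewrite setIidr; last exact: kj.
    have MB : (M (code_halfline c j) - M (code_halfline c k) < e%:E)%E.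
      rewrite -(fineK (Mfin k)) -(fineK (Mfin j)) -EFinB lte_fin.
      by apply: lt_trans ne; rewrite ltrBlDl.
    exact: MB.
  apply: filterS3 (rc_setT rcF) FA Asmall => w FT FA small e /andP[e0 e1].
  have [j] := small _ e0; have [lt_kj Fe|kj'] := ltP (rat_seq k : R) (rat_seq j).
    by exists j; split => //; rewrite FA// ltrD2l.
  by rewrite /A (ltNge (rat_seq k)) kj' FT ltNge e1.
near=> w.
have h1 : forall i j, rat_seq i <= rat_seq j :> R -> x w i <= x w j.
  by near: w.
have h2 : forall k, x w k <= 1 by near: w.
have h3 : forall e, 0 < e -> exists k, x w k < e by near: w.
have h4 : forall e, 0 < e -> exists k, 1 - e < x w k by near: w.
have h5 : forall k e, 0 < e <= 1 -> exists j,
    rat_seq k < rat_seq j :> R /\ x w j < x w k + e by near: w.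
split => [//|k|n|n|k n].
- by rewrite h2 andbT (rc_ge0 rcF).
- by apply: h3; rewrite invr_gt0.
- by apply: h4; rewrite invr_gt0.
- by apply: h5; rewrite invr_gt0 ltr0n invf_le1// ler1n.
Unshelve. all: by end_near. Qed.

(** Dynkin induction from the half-lines. Each step involves countably many sets, so almost sure
    statements survive it. *)
Lemma rc_cdf_measure A : measurable A ->
  \forall w \ae P, cdf_measure (x w) A = (F (code c @^-1` A) w)%:E.
Proof.
have mcA B : measurable B -> measurable (code c @^-1` B).
  by move=> mB; rewrite -[X in measurable X]setTI; exact: measurable_code.
move=> mA.
apply: (@dynkin_induction _ R (range halfline) (fun A => \forall w \ae P,
  cdf_measure (x w) A = (F (code c @^-1` A) w)%:E) halflineER halflineI);
  last by rewrite -halflineER.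
- by apply: filterS (rc_setT rcF) => w; rewrite probability_setT preimage_setT => ->.
- by move=> _ [k _ <-]; apply: filterS rc_cdf_seq => w /cdf_measureE ->.
- move=> S mS; apply: filterS2 (rc_setC (mcA _ mS)) => w.
  by rewrite probability_setC// preimage_setC => -> ->.
- move=> B mB tB PB.
  (* The tails [D n] decrease to the empty set, so [rc_small] makes [F (D n)] arbitrarily small
     almost surely; finite additivity leaves exactly this remainder after n terms. *)
  pose C n := code c @^-1` B n; pose D n := \bigcup_(k >= n) C k.
  have mC n : measurable (C n) by exact: mcA.
  have mD n : measurable (D n) by exact: bigcup_measurable.
  have DS n : D n = C n `|` D n.+1.
    apply/seteqP; split => t.
      move=> [k /=]; rewrite leq_eqVlt => /predU1P[<-|nk] Ck; first by left.
      by right; exists k.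
    by move=> [Cn|[k /= nk Ck]]; [exists n => //=|exists k => //=; exact: ltnW].
  have CD n : C n `&` D n.+1 = set0.
    apply/seteqP; split => // t [/= Cn [k /= nk Ck]].
    have /trivIsetP/(_ n k I I) := tB; rewrite neq_ltn nk => /(_ isT).
    by move/seteqP => [/(_ (code c t)) + _]; apply.
  have FD : \forall w \ae P, forall n, F (D n) w = F (C n) w + F (D n.+1) w.
    apply: ae_foralln => n; rewrite DS.
    exact: (rc_setU rcF (mC n) (mD n.+1) (CD n)).
  have Dsmall : \forall w \ae P, forall e, 0 < e -> exists n, F (D n) w < e.
    apply: (rc_small mD) => e e0.
    have D0 : \bigcap_n D n = set0.
      apply/seteqP; split => // t h; have [k _ Ck] := h 0%N I.
      have [j /= kj Cj] := h k.+1 I.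
      have /trivIsetP/(_ k j I I) := tB; rewrite neq_ltn kj => /(_ isT).
      by move/seteqP => [/(_ (code c t)) + _]; apply.
    have MD0 : (M (D 0%N) < +oo)%E.
      by rewrite ltey_eq (fin_num_measure M _ (mD 0%N)).
    have : M \o D @ \oo --> M (\bigcap_n D n).
      apply: nonincreasing_cvg_mu => //.
      - by rewrite D0; exact: measurable0.
      - apply/nonincreasing_seqP => n; apply/subsetPset.
        by rewrite [X in _ `<=` X]DS; right.
    rewrite D0 measure0 => /fine_cvgP[_ /(@cvgrPdist_lt _ R^o)/(_ _ e0)][n _ h].
    exists n; have := h n (leqnn n).
    rewrite /= sub0r normrN ger0_norm ?fine_ge0// => ?.
    by rewrite -(fineK (fin_num_measure M _ (mD n))) lte_fin.
  have PB' : \forall w \ae P, forall n,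
      cdf_measure (x w) (B n) = (F (C n) w)%:E by exact: ae_foralln.
  apply: filterS3 FD Dsmall PB' => w FD Dsmall PB'.
  have UE : code c @^-1` (\bigcup_k B k) = D 0%N.
    by apply/seteqP; split => t [k _ Bk]; exists k.
  have FDn n : F (D 0%N) w = \sum_(k < n) F (C k) w + F (D n) w.
    elim: n => [|n IH]; first by rewrite big_ord0 add0r.
    by rewrite big_ord_recr/= -addrA -FD.
  rewrite UE measure_semi_bigcup//; last exact: bigcup_measurable.
  rewrite (eq_eseriesr (fun k _ => PB' k)).
  apply/eqP; rewrite eq_le; apply/andP; split.
    apply: lime_le.
      by apply: is_cvg_nneseries => *; rewrite lee_fin (rc_ge0 rcF).
    apply: nearW => n; rewrite big_mkord sumEFin lee_fin (FDn n) lerDl.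
    exact: (rc_ge0 rcF).
  apply/lee_addgt0Pr => e /Dsmall[n /ltW ne].
  apply: (@le_trans _ _ ((\sum_(k < n) F (C k) w)%:E + e%:E)%E).
    by rewrite -EFinD lee_fin (FDn n) lerD2l.
  apply: leeD => //; rewrite -sumEFin -(big_mkord xpredT (fun k => (F (C k) w)%:E)).
  by apply: nneseries_lim_ge => k _; rewrite lee_fin (rc_ge0 rcF).
Qed.

Lemma measurable_rc_encode : measurable_fun setT (fun w => encode (x w)).
Proof. by apply: measurable_encode => k; exact: (rc_measurable rcF). Qed.

Lemma rc_universal_kernel A : measurable A ->
  \forall w \ae P, universal_kernel c (encode (x w)) A = (F A w)%:E.
Proof.
move=> mA; have mcA : measurable (uncode c @^-1` A).
  by rewrite -[X in measurable X]setTI; exact: measurable_uncode.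
apply: filterS (rc_cdf_measure mcA) => w.
by rewrite universal_kernel_encode// preimage_codeK.
Qed.

End random_contents.

(** * Exchangeable sequences *)

Section bounded_expectation.
Context {R : realType} d (Omega : measurableType d) (P : probability Omega R).

Definition bounded_measurable (f : Omega -> R) :=
  measurable_fun setT f /\ exists K, forall w, `|f w| <= K.

Local Notation bm := bounded_measurable.

Definition mean (f : Omega -> R) : R := (\int[P]_w f w)%R.

Lemma bm_integrable f : bm f -> P.-integrable setT (EFin \o f).
Proof.
move=> [mf [K fK]]; apply: measurable_bounded_integrable => //.
  exact: fin_num_fun_lty.
by exists K; split; [exact: num_real|move=> x Kx w _; exact: le_trans (ltW Kx)].
Qed.

Lemma bm_cst r : bm (cst r).
Proof. by split; [exact: measurable_cst|exists `|r|]. Qed.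

Lemma bm_indic A : measurable A -> bm \1_A.
Proof.
move=> mA; split; first exact: measurable_indic.
by exists 1 => w; rewrite indicE; case: (_ \in _); rewrite ?normr1 ?normr0.
Qed.

Lemma bmD f g : bm f -> bm g -> bm (fun w => f w + g w).
Proof.
move=> [mf [K fK]] [mg [L gL]]; split; first exact: measurable_funD.
by exists (K + L) => w; rewrite (le_trans (ler_normD _ _))// lerD.
Qed.

Lemma bmN f : bm f -> bm (fun w => - f w).
Proof.
move=> [mf [K fK]]; split; first exact: measurableT_comp.
by exists K => w; rewrite normrN.
Qed.

Lemma bmM f g : bm f -> bm g -> bm (fun w => f w * g w).
Proof.
move=> [mf [K fK]] [mg [L gL]]; split; first exact: measurable_funM.
by exists (K * L) => w; rewrite normrM ler_pM.
Qed.

Lemma bmB f g : bm f -> bm g -> bm (fun w => f w - g w).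
Proof. by move=> bf bg; apply: bmD => //; exact: bmN. Qed.

Lemma bmZ r f : bm f -> bm (fun w => r * f w).
Proof. by apply: bmM; exact: bm_cst. Qed.

Lemma bm_norm f : bm f -> bm (fun w => `|f w|).
Proof.
move=> [mf [K fK]]; split; first exact: measurableT_comp.
by exists K => w; rewrite normr_id.
Qed.

Lemma bm_sum I (r : seq I) (f : I -> Omega -> R) :
  (forall i, bm (f i)) -> bm (fun w => \sum_(i <- r) f i w).
Proof.
move=> bf; elim: r => [|i r IH].
  by under eq_fun do rewrite big_nil; exact: (bm_cst 0).
by under eq_fun do rewrite big_cons; exact: bmD.
Qed.

Lemma bm_prod I (r : seq I) (f : I -> Omega -> R) :
  (forall i, bm (f i)) -> bm (fun w => \prod_(i <- r) f i w).
Proof.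
move=> bf; elim: r => [|i r IH].
  by under eq_fun do rewrite big_nil; exact: (bm_cst 1).
by under eq_fun do rewrite big_cons; exact: bmM.
Qed.

Lemma EFin_mean f : bm f -> (mean f)%:E = (\int[P]_w (f w)%:E)%E.
Proof.
move=> bf; rewrite /mean /Rintegral fineK//; apply: integrable_fin_num => //.
exact: bm_integrable.
Qed.

Lemma mean_cst r : mean (cst r) = r.
Proof.
transitivity (r * fine (P setT)); first exact: Rintegral_cst.
by rewrite probability_setT mulr1.
Qed.

Lemma meanD f g : bm f -> bm g -> mean (fun w => f w + g w) = mean f + mean g.
Proof. by move=> bf bg; apply: RintegralD => //; exact: bm_integrable. Qed.

Lemma meanB f g : bm f -> bm g -> mean (fun w => f w - g w) = mean f - mean g.
Proof. by move=> bf bg; apply: RintegralB => //; exact: bm_integrable. Qed.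

Lemma meanZ r f : bm f -> mean (fun w => r * f w) = r * mean f.
Proof. by move=> bf; apply: RintegralZl => //; exact: bm_integrable. Qed.

Lemma le_mean f g : bm f -> bm g -> (forall w, f w <= g w) -> mean f <= mean g.
Proof.
by move=> bf bg fg; apply: le_Rintegral => //; exact: bm_integrable.
Qed.

Lemma mean_ge0 f : (forall w, 0 <= f w) -> 0 <= mean f.
Proof. by move=> f0; exact: Rintegral_ge0. Qed.

Lemma mean_sum I (r : seq I) (f : I -> Omega -> R) : (forall i, bm (f i)) ->
  mean (fun w => \sum_(i <- r) f i w) = \sum_(i <- r) mean (f i).
Proof.
move=> bf; elim: r => [|i r IH].
  by under eq_fun do rewrite big_nil; rewrite big_nil; exact: (mean_cst 0).
under eq_fun do rewrite big_cons.
by rewrite big_cons -IH -meanD//; exact: bm_sum.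
Qed.

Lemma mean_indic A : measurable A -> mean \1_A = fine (P A).
Proof. by move=> mA; rewrite /mean /Rintegral integral_indic// setIT. Qed.

(* AM-GM: [|f| <= (e + f ^ 2 / e) / 2]. *)
Lemma mean_norm_le f (e : R) : bm f -> 0 < e ->
  mean (fun w => `|f w|) <= (e + e^-1 * mean (fun w => f w * f w)) / 2.
Proof.
move=> bf e0; have bff := bmM bf bf.
rewrite -{1}(mean_cst e) -meanZ// -meanD; [|exact: bm_cst|exact: bmZ].
rewrite mulrC -meanZ; last by apply: bmD; [exact: bm_cst|exact: bmZ].
apply: le_mean.
- exact: bm_norm.
- by apply: bmZ; apply: bmD; [exact: bm_cst|exact: bmZ].
move=> w /=; rewrite -subr_ge0.
have -> : f w * f w = `|f w| * `|f w|.
  by rewrite -normrM ger0_norm// -expr2 sqr_ge0.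
have -> : 2^-1 * (e + e^-1 * (`|f w| * `|f w|)) - `|f w| =
          2^-1 * e^-1 * (e - `|f w|) ^+ 2.
  by field; exact: lt0r_neq0.
by rewrite mulr_ge0 ?sqr_ge0// mulr_ge0 ?invr_ge0// ltW.
Qed.

Lemma norm_mean_le f : bm f -> `|mean f| <= mean (fun w => `|f w|).
Proof. by move=> bf; apply: le_normr_Rintegral => //; exact: bm_integrable. Qed.

End bounded_expectation.

(** Factors are exchanged one at a time, the others being at most 1. This reduces products of
    empirical means to the L^1 distance of single factors. *)
Lemma norm_prod_sub {R : realType} I (r : seq I) (a b : I -> R) :
  (forall i, 0 <= a i <= 1) -> (forall i, 0 <= b i <= 1) ->
  `|\prod_(i <- r) a i - \prod_(i <- r) b i| <= \sum_(i <- r) `|a i - b i|.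
Proof.
move=> a01 b01; elim: r => [|i r IH]; first by rewrite !big_nil subrr normr0.
rewrite !big_cons.
set p := \prod_(j <- r) a j in IH *; set q := \prod_(j <- r) b j in IH *.
have -> : a i * p - b i * q = (a i - b i) * p + b i * (p - q) by ring.
apply: (le_trans (ler_normD _ _)); apply: lerD; rewrite normrM.
  have [p0 p1] : 0 <= p /\ p <= 1.
    split; first by apply: prodr_ge0 => j _; case/andP: (a01 j).
    by rewrite /p; apply: prodr_ile1 => j _; exact: a01.
  by rewrite ler_piMr// ger0_norm.
case/andP: (b01 i) => b0 b1; apply: le_trans IH.
by rewrite ler_piMl// ger0_norm.
Qed.

(** Exchangeability speaks of permutations, whereas arbitrary distinct indices are needed. In the
    induction, composing with the transposition of [s ok] and [f ok] corrects the value at k;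
    injectivity of [s] and of [f] keeps the earlier values away from both points. *)
Lemma perm_extension n (f : 'I_n -> 'I_n) k : (k <= n)%N ->
  (forall i j : 'I_n, (i < k)%N -> (j < k)%N -> f i = f j -> i = j) ->
  exists s : 'S_n, forall i : 'I_n, (i < k)%N -> s i = f i.
Proof.
elim: k => [_ _|k IH kn injf]; first by exists 1%g.
have [|s sf] := IH (ltnW kn).
  by move=> i j ik jk; apply: injf; exact: ltnW.
pose ok := Ordinal kn.
exists (s * tperm (s ok) (f ok))%g => i; rewrite permM ltnS leq_eqVlt.
move=> /predU1P[ik|ik].
  have -> : i = ok by exact: val_inj.
  by rewrite tpermL.
have ine : i != ok by apply: contraTneq ik => ->; rewrite ltnn.
rewrite tpermD; first exact: sf.
  by rewrite (inj_eq perm_inj) eq_sym.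
rewrite sf//; apply: contra_neq ine => /esym.
by apply: injf => //=; exact: ltnW.
Qed.

(** * Second moments of empirical means *)

Section exchangeable_sequences.
Context {R : realType} d (Omega : measurableType d) (P : probability Omega R).
Context d' (X : measurableType d') (xi : nat -> Omega -> X).
Hypothesis mxi : forall i, measurable_fun setT (xi i).
Hypothesis exch : forall N (s : 'S_N) (A : 'I_N -> set X),
  (forall i, measurable (A i)) ->
  P [set w | forall i : 'I_N, A i (xi i w)] =
  P [set w | forall i : 'I_N, A i (xi (s i) w)].

Local Notation bm := (@bounded_measurable R _ Omega).
Local Notation mean := (mean P).

Definition hit (A : set X) (i : nat) (w : Omega) : R := \1_A (xi i w).

Lemma hit01 A i w : 0 <= hit A i w <= 1.
Proof. by rewrite /hit indicE; case: (_ \in _); rewrite lexx ler01. Qed.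

Let mpre A i : measurable A -> measurable (xi i @^-1` A).
Proof. by move=> mA; rewrite -[X in measurable X]setTI; exact: mxi. Qed.

Lemma bm_hit A i : measurable A -> bm (hit A i).
Proof. by move=> mA; apply: (bm_indic (mpre i mA)). Qed.

Lemma prod_hitE N (s : nat -> nat) (A : nat -> set X) w :
  \prod_(i < N) hit (A i) (s i) w =
  \1_[set w | forall i : 'I_N, A i (xi (s i) w)] w.
Proof.
rewrite indicE; set S := [set _ | _].
have [/set_mem/= h|/negP h] := boolP (w \in S).
  by rewrite big1// => i _; rewrite /hit indicE (mem_set (h i)).
have [i hi] : exists i : 'I_N, ~ A i (xi (s i) w).
  by apply/existsNP => h'; apply: h; exact: mem_set.
apply/eqP; rewrite prodf_seq_eq0; apply/hasP; exists i.
  exact: mem_index_enum.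
by rewrite /= /hit indicE pnatr_eq0 eqb0; apply/negP => /set_mem.
Qed.

Lemma measurable_hits N (s : nat -> nat) (A : nat -> set X) :
  (forall i, measurable (A i)) ->
  measurable [set w | forall i : 'I_N, A i (xi (s i) w)].
Proof.
move=> mA; rewrite (_ : [set _ | _] =
    \bigcap_i (if (i < N)%N then xi (s i) @^-1` A i else setT)).
  by apply: bigcapT_measurable => i; case: ifPn => // _; exact: mpre.
apply/seteqP; split => w /= h; last first.
  by move=> i; have := h i I; rewrite ltn_ord.
by move=> i _; case: ifPn => // iN; exact: (h (Ordinal iN)).
Qed.

(** The indices and their images all lie in one initial segment, where the injection extends to a
    permutation; the sets are padded by [setT] beyond N, so that only the first N coordinates
    matter. *)
Lemma mean_prod_hit N (s : nat -> nat) (A : nat -> set X) :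
  (forall i j, (i < N)%N -> (j < N)%N -> s i = s j -> i = j) ->
  (forall i, measurable (A i)) ->
  mean (fun w => \prod_(i < N) hit (A i) (s i) w) =
  fine (P [set w | forall i : 'I_N, A i (xi i w)]).
Proof.
move=> injs mA; under eq_fun do rewrite prod_hitE.
rewrite mean_indic; last exact: (measurable_hits N s mA).
congr fine.
pose m := (N + \max_(i < N) s i)%N.
have sm i : (i < N)%N -> (s i < m.+1)%N.
  move=> iN; rewrite ltnS /m (leq_trans _ (leq_addl _ _))//.
  exact: (@leq_bigmax _ (fun i : 'I_N => s i) (Ordinal iN)).
pose f (i : 'I_m.+1) : 'I_m.+1 := inord (s i).
have Nm : (N <= m.+1)%N by rewrite leqW// leq_addr.
have [i j iN jN /(congr1 val)|sg sgE] := @perm_extension _ f N Nm.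
  by rewrite /= !inordK ?sm// => /(injs _ _ iN jN); exact: val_inj.
pose B (i : 'I_m.+1) := if (i < N)%N then A i else setT.
have mB i : measurable (B i) by rewrite /B; case: ifPn.
have := exch sg mB; rewrite [X in P X = _](_ : _ =
    [set w | forall i : 'I_N, A i (xi i w)]); last first.
  apply/seteqP; split => w /= h i; last first.
    by rewrite /B; case: ifPn => // iN; exact: (h (Ordinal iN)).
  by have := h (widen_ord Nm i); rewrite /B /= ltn_ord.
move=> ->; congr (P _); apply/seteqP; split => w /= h i.
  rewrite /B; case: ifPn => // iN; rewrite sgE//= inordK ?sm//.
  exact: (h (Ordinal iN)).
by have := h (widen_ord Nm i); rewrite /B /= ltn_ord sgE//= /f inordK ?sm//=.
Qed.

Definition empirical (A : set X) (s : nat -> nat) n (w : Omega) : R :=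
  n%:R^-1 * \sum_(i < n) hit A (s i) w.

Lemma bm_empirical A s n : measurable A -> bm (empirical A s n).
Proof. by move=> mA; apply: bmZ; apply: bm_sum => i; exact: bm_hit. Qed.

Lemma empirical01 A s n w : 0 <= empirical A s n w <= 1.
Proof.
apply/andP; split.
  apply: mulr_ge0; first by rewrite invr_ge0.
  by apply: sumr_ge0 => i _; case/andP: (hit01 A (s i) w).
have [->|n0] := eqVneq n 0%N; first by rewrite /empirical big_ord0 mulr0.
rewrite ler_pdivrMl ?ltr0n ?lt0n// mulr1.
apply: (@le_trans _ _ (\sum_(i < n) 1)).
  by apply: ler_sum => i _; case/andP: (hit01 A (s i) w).
by rewrite sumr_const card_ord.
Qed.

Section second_moments.
Variable A : set X.
Hypothesis mA : measurable A.

(** By exchangeability [p] is the mean of every hit and [q] the mean of every product of two hits at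
    distinct indices; coinciding indices add p - q to [q]. *)
Let p := mean (hit A 0).
Let q := mean (fun w => hit A 0 w * hit A 1 w).

Let hit_sq i w : hit A i w * hit A i w = hit A i w.
Proof. by rewrite /hit indicE -natrM mulnb andbb. Qed.

Let mean_hit i : mean (hit A i) = p.
Proof.
have h s : mean (hit A (s 0%N)) = fine (P [set w | forall i : 'I_1, A (xi i w)]).
  rewrite -(@mean_prod_hit 1 s (fun=> A))//; last by case=> // -[].
  by congr mean; apply/funext => w; rewrite big_ord1.
exact: etrans (h (fun=> i)) (esym (h id)).
Qed.

Let mean_hitM i j : i != j -> mean (fun w => hit A i w * hit A j w) = q.
Proof.
move=> ij; have h s : s 0%N != s 1%N ->
    mean (fun w => hit A (s 0%N) w * hit A (s 1%N) w) =
    fine (P [set w | forall i : 'I_2, A (xi i w)]).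
  move=> s01; rewrite -(@mean_prod_hit 2 s (fun=> A))//; last first.
    by move=> [|[|?]] [|[|?]]//= _ _ => [/eqP|/esym/eqP]; rewrite (negbTE s01).
  by congr mean; apply/funext => w; rewrite !big_ord_recl big_ord0 mulr1.
exact: etrans (h (fun k => if k == 0%N then i else j) ij) (esym (h id isT)).
Qed.

Let pq : q <= p.
Proof.
apply: le_mean.
- by apply: bmM; exact: bm_hit.
- exact: bm_hit.
move=> w; case/andP: (hit01 A 0 w) => *; case/andP: (hit01 A 1 w) => *.
by rewrite ler_piMr.
Qed.

Let mean_hitME i j :
  mean (fun w => hit A i w * hit A j w) = q + (i == j)%:R * (p - q).
Proof.
have [->|ij] := eqVneq i j; last by rewrite mean_hitM// mul0r addr0.
by rewrite mul1r addrC subrK; under eq_fun do rewrite hit_sq; exact: mean_hit.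
Qed.

Let mean_empiricalM s t n m :
  mean (fun w => empirical A s n w * empirical A t m w) =
  (n%:R^-1 * m%:R^-1) *
  \sum_(i < n) \sum_(j < m) (q + (s i == t j)%:R * (p - q)).
Proof.
have bh i : bm (hit A i) by exact: bm_hit.
transitivity (mean (fun w => (n%:R^-1 * m%:R^-1) *
    \sum_(i < n) \sum_(j < m) hit A (s i) w * hit A (t j) w)).
  congr mean; apply/funext => w; rewrite /empirical mulrACA; congr (_ * _).
  by rewrite mulr_suml; apply: eq_bigr => i _; rewrite mulr_sumr.
rewrite meanZ; last by do 2 apply: bm_sum => ?; exact: bmM.
congr (_ * _); rewrite mean_sum; last by move=> i; apply: bm_sum => j; exact: bmM.
apply: eq_bigr => i _; rewrite mean_sum; last by move=> j; exact: bmM.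
by apply: eq_bigr => j _; rewrite mean_hitME.
Qed.

Let q1 : p - q <= 1.
Proof.
rewrite lerBlDr; apply: (@le_trans _ _ 1).
  rewrite -(mean_cst P 1); apply: le_mean; [exact: bm_hit|exact: bm_cst|].
  by move=> w; case/andP: (hit01 A 0 w).
rewrite lerDl; apply: mean_ge0 => w.
by apply: mulr_ge0; [case/andP: (hit01 A 0 w)|case/andP: (hit01 A 1 w)].
Qed.

(** Each square has mean at most [q] plus the diagonal term 1 / n or 1 / m, while the cross term has
    mean at least [q] however much [s] and [t] overlap, since coincidences only add p - q >= 0. The
    terms in [q] cancel. *)
Lemma mean_empirical_sub_sq s t n m : (0 < n)%N -> (0 < m)%N ->
  (forall i j, (i < n)%N -> (j < n)%N -> s i = s j -> i = j) ->
  (forall i j, (i < m)%N -> (j < m)%N -> t i = t j -> i = j) ->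
  mean (fun w => (empirical A s n w - empirical A t m w) *
                 (empirical A s n w - empirical A t m w)) <=
  n%:R^-1 + m%:R^-1.
Proof.
have sq_le r k : (0 < k)%N ->
    (forall i j, (i < k)%N -> (j < k)%N -> r i = r j -> i = j) ->
    mean (fun w => empirical A r k w * empirical A r k w) <= q + k%:R^-1.
  move=> k0 injr; have k0' : k%:R != 0 :> R by rewrite pnatr_eq0 -lt0n.
  rewrite mean_empiricalM.
  have -> : \sum_(i < k) \sum_(j < k) (q + (r i == r j)%:R * (p - q)) =
            k%:R * (k%:R * q + (p - q)).
    rewrite mulr_natl -[in RHS](card_ord k) -sumr_const; apply: eq_bigr => i _.
    rewrite big_split/= sumr_const card_ord [k%:R * q]mulr_natl; congr (_ + _).
    rewrite (bigD1 i)//= eqxx mul1r big1 ?addr0// => j ji.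
    rewrite (_ : _ == _ = false) ?mul0r//; apply/negP => /eqP/injr ij.
    by move/eqP: ji; apply; apply/val_inj/esym/ij.
  have -> : k%:R^-1 / k%:R * (k%:R * (k%:R * q + (p - q))) =
            q + k%:R^-1 * (p - q) by field.
  by rewrite lerD2l ler_piMr// invr_ge0.
have cross_ge : (0 < n)%N -> (0 < m)%N ->
    q <= mean (fun w => empirical A s n w * empirical A t m w).
  move=> n0 m0; rewrite mean_empiricalM -invfM ler_pdivlMl; last first.
    by rewrite mulr_gt0// ltr0n.
  rewrite -mulrA mulr_natl -[in leLHS](card_ord n) -sumr_const.
  apply: ler_sum => i _; rewrite mulr_natl -[in leLHS](card_ord m) -sumr_const.
  by apply: ler_sum => j _; rewrite lerDl mulr_ge0// subr_ge0.
move=> n0 m0 injs injt.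
set a := empirical A s n; set b := empirical A t m.
have ba : bm a by exact: bm_empirical.
have bb : bm b by exact: bm_empirical.
rewrite (_ : (fun w => _) =
    (fun w => (a w * a w + b w * b w) - 2 * (a w * b w))); last first.
  by apply/funext => w; ring.
rewrite meanB ?meanD ?meanZ//; do ?[exact: bmM|by apply: bmD; exact: bmM|
  by apply: bmZ; exact: bmM].
have := sq_le s n n0 injs; have := sq_le t m m0 injt; have := cross_ge n0 m0.
rewrite -/a -/b.
move: (mean _) (mean _) (mean _) => u v w; lra.
Qed.

End second_moments.

End exchangeable_sequences.

(** * Limiting frequencies and the product formula *)

Section limiting_frequencies.
Context {R : realType} d (Omega : measurableType d) (P : probability Omega R).
Context d' (X : measurableType d') (xi : nat -> Omega -> X).
Hypothesis mxi : forall i, measurable_fun setT (xi i).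
Hypothesis exch : forall N (s : 'S_N) (A : 'I_N -> set X),
  (forall i, measurable (A i)) ->
  P [set w | forall i : 'I_N, A i (xi i w)] =
  P [set w | forall i : 'I_N, A i (xi (s i) w)].

Local Notation bm := (@bounded_measurable R _ Omega).
Local Notation mean := (mean P).
Local Notation emp := (@empirical R d Omega d' X xi).

Let freq A j := emp A id (4 ^ j)%N.

Let bm_freq A j : measurable A -> bm (freq A j).
Proof. by move=> mA; exact: bm_empirical. Qed.

Let expn4_gt0 j : (0 < 4 ^ j)%N. Proof. by rewrite expn_gt0. Qed.

(** The second moment is at most 2 * 4 ^ (- j), and [mean_norm_le] with e = 2 ^ (- j) turns this
    into 3 / 2 * 2 ^ (- j). The index sequences are arbitrary injections: the same bound serves for
    convergence and for the comparison of blocks with initial segments. *)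
Lemma mean_empirical_dist A s t i j : measurable A -> (j <= i)%N ->
  (forall k l, (k < 4 ^ i)%N -> (l < 4 ^ i)%N -> s k = s l -> k = l) ->
  (forall k l, (k < 4 ^ j)%N -> (l < 4 ^ j)%N -> t k = t l -> k = l) ->
  mean (fun w => `|emp A s (4 ^ i)%N w - emp A t (4 ^ j)%N w|) <=
  2 * 2^-1 ^+ j.
Proof.
move=> mA ji injs injt.
have e0 : 0 < 2^-1 ^+ j :> R by rewrite exprn_gt0.
have bd : bm (fun w => emp A s (4 ^ i)%N w - emp A t (4 ^ j)%N w).
  by apply: bmB; exact: bm_empirical.
apply: (le_trans (mean_norm_le P bd e0)).
have h := @mean_empirical_sub_sq R _ _ P _ _ xi mxi exch A mA s t _ _
  (expn4_gt0 i) (expn4_gt0 j) injs injt.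
have le4 : (4 ^ i)%:R^-1 <= (4 ^ j)%:R^-1 :> R.
  by rewrite lef_pV2 ?posrE ?ltr0n// ler_nat leq_exp2l.
have E4 : (4 ^ j)%:R^-1 = 2^-1 ^+ j * 2^-1 ^+ j :> R.
  rewrite -exprMn natrX -exprVn; congr (_ ^+ _).
  by field.
move: (mean _) h => u h.
have hu : (2^-1 ^+ j)^-1 * u <= 2 * 2^-1 ^+ j.
  by rewrite ler_pdivrMl//; move: h le4; rewrite E4; lra.
by rewrite ler_pdivrMr//; lra.
Qed.

(* An upper limit is defined and measurable everywhere; it is almost surely a
   limit ([ae_frequency]). *)
Definition frequency A w : R := fine (limn_esup (fun j => (freq A j w)%:E)).

Lemma frequency01 A w : 0 <= frequency A w <= 1.
Proof.
have [h0 h1] : (0 <= limn_esup (fun j => (freq A j w)%:E) /\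
    limn_esup (fun j => (freq A j w)%:E) <= 1)%E.
  rewrite limn_esup_lim; split.
    apply: lime_ge; first exact: is_cvg_esups.
    apply: nearW => n; apply: (@le_trans _ _ (freq A n w)%:E).
      by rewrite lee_fin; case/andP: (@empirical01 R _ _ _ _ xi A id (4 ^ n)%N w).
    by apply: ereal_sup_ubound; exists n => /=.
  apply: lime_le; first exact: is_cvg_esups.
  apply: nearW => n; apply: ge_ereal_sup => _ [j _ <-].
  by rewrite lee_fin; case/andP: (@empirical01 R _ _ _ _ xi A id (4 ^ j)%N w).
have hf : limn_esup (fun j => (freq A j w)%:E) \is a fin_num.
  by rewrite ge0_fin_numE// (le_lt_trans h1)// ltry.
by rewrite -!lee_fin /frequency fineK// h0.
Qed.

Lemma measurable_frequency A : measurable A -> measurable_fun setT (frequency A).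
Proof.
move=> mA; apply: measurableT_comp; first exact: fine_measurable.
apply: measurable_fun_limn_esup => j; apply/measurable_EFinP.
by case: (bm_freq j mA).
Qed.

Lemma bm_frequency A : measurable A -> bm (frequency A).
Proof.
move=> mA; split; first exact: measurable_frequency.
by exists 1 => w; have /andP[? ?] := frequency01 A w; rewrite ger0_norm.
Qed.

Lemma frequency_cvg A w l : freq A j w @[j --> \oo] --> l -> frequency A w = l.
Proof.
move=> fl; rewrite /frequency limn_esup_lim.
have /cvg_esups/cvg_lim -> // : (freq A j w)%:E @[j --> \oo] --> l%:E.
by apply: cvg_EFin => //; exact: nearW.
Qed.

(** The means of the absolute increments are summable, so their sum is integrable, hence finite
    almost surely, and the telescoping series converges absolutely. *)
Lemma ae_frequency A : measurable A ->
  \forall w \ae P, freq A j w @[j --> \oo] --> frequency A w.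
Proof.
move=> mA.
pose D j w := `|freq A j.+1 w - freq A j w|.
have bD j : bm (D j) by apply: bm_norm; apply: bmB; exact: bm_freq.
have meanD j : mean (D j) <= 2 * 2^-1 ^+ j.
  by apply: mean_empirical_dist.
have sumD : (\sum_(0 <= j <oo) (mean (D j))%:E < +oo)%E.
  apply: (@le_lt_trans _ _ 4%:E); last exact: ltry.
  apply: lime_le.
    apply: is_cvg_nneseries => j _ _; rewrite lee_fin; apply: mean_ge0 => w.
    exact: normr_ge0.
  apply: nearW => n; rewrite big_mkord sumEFin lee_fin.
  (* The partial sum of the bounds 2 * 2 ^ (- j) over j < n. *)
  apply: (@le_trans _ _ (4 - 4 * 2^-1 ^+ n)); last first.
    by rewrite lerBlDr lerDl mulr_ge0// exprn_ge0.
  elim: n => [|n IH]; first by rewrite big_ord0 expr0 mulr1 subrr.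
  by rewrite big_ord_recr/=; have := meanD n; rewrite exprS; lra.
have mD j : measurable_fun setT (fun w => (D j w)%:E).
  by apply/measurable_EFinP; case: (bD j).
have D0 j w : (0 <= (D j w)%:E)%E by rewrite lee_fin normr_ge0.
have iD : P.-integrable setT (fun w => \sum_(0 <= j <oo) (D j w)%:E)%E.
  apply/integrableP; split; first exact: ge0_emeasurable_sum.
  under eq_integral => w _ do rewrite gee0_abs ?nneseries_ge0//.
  rewrite integral_nneseries//.
  by under eq_eseriesr => j _ do rewrite -(EFin_mean P (bD j)).
apply: filterS (integrable_ae measurableT iD) => w /(_ I) fw.
suff cw : cvgn (fun j => freq A j w).
  by rewrite (frequency_cvg cw).
rewrite (_ : (fun j => _) = (fun j => freq A 0 w +
    series (telescope (fun j => freq A j w)) j)); last first.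
  by apply/funext => j; exact: eq_sum_telescope.
apply: is_cvgD; first exact: is_cvg_cst.
apply: normed_cvg; apply: nondecreasing_is_cvgn.
  by apply: nondecreasing_series => n _ _ /=.
exists (fine (\sum_(0 <= j <oo) (D j w)%:E)) => _ [n _ <-].
rewrite -lee_fin fineK// -sumEFin.
exact: (nneseries_lim_ge (u_ := fun j => (D j w)%:E)).
Qed.

Lemma cvg_frequencies N (A : nat -> set X) : (forall i, measurable (A i)) ->
  mean (fun w => \prod_(i < N) freq (A i) j w) @[j --> \oo] -->
  mean (fun w => \prod_(i < N) frequency (A i) w).
Proof.
move=> mA.
have prod01 (a : nat -> R) : (forall i, 0 <= a i <= 1) ->
    `|\prod_(i < N) a i| <= 1.
  move=> a01; rewrite ger0_norm; last first.
    by apply: prodr_ge0 => i _; case/andP: (a01 i).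
  by apply: prodr_ile1 => i _; exact: a01.
have bf j : bm (fun w => \prod_(i < N) freq (A i) j w).
  by apply: bm_prod => i; exact: bm_freq.
have bF : bm (fun w => \prod_(i < N) frequency (A i) w).
  by apply: bm_prod => i; exact: bm_frequency.
have aec : \forall w \ae P, forall i,
    freq (A i) j w @[j --> \oo] --> frequency (A i) w.
  by apply: ae_foralln => i; exact: ae_frequency.
have cF : {ae P, forall w, setT w ->
    (\prod_(i < N) freq (A i) j w)%:E @[j --> \oo] -->
    (\prod_(i < N) frequency (A i) w)%:E}.
  apply: filterS aec => w cw _; apply: cvg_EFin; first exact: nearW.
  rewrite /=; elim: (index_enum _) => [|i r IH].
    by under eq_fun do rewrite big_nil; rewrite big_nil; exact: cvg_cst.
  by under eq_fun do rewrite big_cons; rewrite big_cons; apply: cvgM.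
have i1 : P.-integrable setT (cst 1%E).
  exact: (bm_integrable P (@bm_cst R _ Omega 1)).
have F1 : {ae P, forall w n, setT w ->
    (`|(\prod_(i < N) freq (A i) n w)%:E| <= cst 1 w)%E}.
  apply: nearW => w n _; rewrite lee_fin.
  apply: (prod01 (fun i => freq (A i) n w)) => i.
  exact: empirical01.
have [_ _] := dominated_convergence measurableT
  (fun j => (measurable_EFinP _ _).2 (bf j).1)
  ((measurable_EFinP _ _).2 bF.1) cF i1 F1.
by rewrite -EFin_mean// => /fine_cvg.
Qed.

(* The blocks [l * N + i] are disjoint for distinct [i < N], so that every term
   of the expanded product involves [N] distinct indices. *)
Lemma mean_prod_empirical N n (A : nat -> set X) : (0 < n)%N ->
  (forall i, measurable (A i)) ->
  mean (fun w => \prod_(i < N) emp (A i) (fun l => l * N + i)%N n w) =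
  fine (P [set w | forall i : 'I_N, A i (xi i w)]).
Proof.
move=> n0 mA; set p := RHS.
have bh i j : bm (hit xi (A i) j) by exact: bm_hit.
transitivity (mean (fun w => n%:R^-1 ^+ N * \sum_(f : {ffun 'I_N -> 'I_n})
    \prod_(i < N) hit xi (A i) (f i * N + i) w)).
  congr mean; apply/funext => w; rewrite big_split/= prodr_const card_ord.
  by rewrite bigA_distr_bigA.
rewrite meanZ; last by apply: bm_sum => f; exact: bm_prod.
rewrite mean_sum; last by move=> f; exact: bm_prod.
rewrite (eq_bigr (fun=> p)) => [|f _].
  rewrite sumr_const card_ffun !card_ord -[p *+ _]mulr_natl natrX mulrA.
  by rewrite -exprMn mulVf ?expr1n ?mul1r// pnatr_eq0 -lt0n.
(* A total version of the block indices; the default 0 is only taken for k >= N. *)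
pose s k := oapp (fun i : 'I_N => f i * N + i)%N 0%N (insub k).
have sE (i : 'I_N) : s i = (f i * N + i)%N by rewrite /s valK.
rewrite /p -(@mean_prod_hit R _ _ P _ _ xi mxi exch N s A)//.
  by congr mean; apply/funext => w; apply: eq_bigr => i _; rewrite sE.
move=> i j iN jN; rewrite (sE (Ordinal iN)) (sE (Ordinal jN))/=.
(* Block i is the residue class of i modulo N, so reduction modulo N gives i back. *)
move=> /(congr1 (modn^~ N)); rewrite !modnMDl !modn_small//.
Qed.

(** For disjoint blocks the product formula holds exactly at every stage j. Replacing the blocks by
    the initial segment costs at most 2 * 2 ^ (- j) in L^1 for each of the N factors, so both have
    the same limit. *)
Lemma mean_prod_frequency N (A : nat -> set X) : (forall i, measurable (A i)) ->
  mean (fun w => \prod_(i < N) frequency (A i) w) =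
  fine (P [set w | forall i : 'I_N, A i (xi i w)]).
Proof.
move=> mA; set p := RHS.
have /(cvg_lim (@Rhausdorff R)) <- := @cvg_frequencies N A mA.
apply/(cvg_lim (@Rhausdorff R)).
apply/(@cvgrPdist_le _ R^o) => e e0.
near=> j.
rewrite /= /p -(@mean_prod_empirical N _ A (expn4_gt0 j) mA).
have be i s n : bm (emp (A i) s n) by exact: bm_empirical.
have bp (s : nat -> nat -> nat) n :
  bm (fun w => \prod_(i < N) emp (A i) (s i) n w).
  by apply: bm_prod => i; exact: be.
have bpB := bmB (bp (fun i l => l * N + i)%N (4 ^ j)%N) (bp (fun=> id) (4 ^ j)%N).
rewrite -meanB; [|exact: (bp (fun i l => l * N + i)%N)|exact: (bp (fun=> id))].
apply: (le_trans (norm_mean_le P bpB)).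
apply: (@le_trans _ _ (N%:R * (2 * 2^-1 ^+ j))); last first.
  near: j.
  have : N%:R * (2 * 2^-1 ^+ j) @[j --> \oo] --> (0 : R).
    rewrite -(mulr0 N%:R); apply: cvgMr; rewrite -(mulr0 2); apply: cvgMr.
    by apply: cvg_expr; rewrite ger0_norm// invf_lt1// ltr1n.
  move=> /(@cvgrPdist_le _ R^o)/(_ _ e0); apply: filterS => j.
  by rewrite sub0r normrN; apply: le_trans; exact: ler_norm.
apply: (@le_trans _ _ (mean (fun w => \sum_(i < N)
    `|emp (A i) (fun l => l * N + i)%N (4 ^ j)%N w - freq (A i) j w|))).
  apply: le_mean.
  - exact: bm_norm bpB.
  - by apply: bm_sum => i; apply: bm_norm; apply: bmB; exact: be.
  by move=> w; apply: norm_prod_sub => i; exact: empirical01.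
rewrite mean_sum; last by move=> i; apply: bm_norm; apply: bmB; exact: be.
rewrite mulr_natl -[in leRHS](card_ord N) -sumr_const; apply: ler_sum => i _.
apply: mean_empirical_dist => // k l _ _ /addIn/eqP.
by rewrite eqn_pmul2r ?(leq_ltn_trans _ (ltn_ord i))// => /eqP.
Unshelve. all: by end_near. Qed.

Lemma measurable_cylinder N (A : nat -> set X) : (forall i, measurable (A i)) ->
  measurable [set w | forall i : 'I_N, A i (xi i w)].
Proof. exact: (measurable_hits mxi N id). Qed.

Let law0 : probability X R := law P (mxi 0).

(** Additivity passes to the limit wherever the two frequencies converge; the means are the case N =
    1 of the product formula. *)
Lemma frequency_random_content : random_content P law0 frequency.
Proof.
split.
- exact: measurable_frequency.
- by move=> A w _; case/andP: (frequency01 A w).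
- move=> A B mA mB AB.
  apply: filterS2 (ae_frequency mA) (ae_frequency mB) => w cA cB.
  apply: frequency_cvg.
  rewrite (_ : (fun j => _) = (fun j => freq A j w + freq B j w)).
    exact: cvgD.
  apply/funext => j; rewrite /freq /empirical -mulrDr -big_split/=; congr (_ * _).
  apply: eq_bigr => i _; rewrite /hit !indicE in_setU.
  have [iA|iA] := boolP (xi i w \in A); have [iB|iB] := boolP (xi i w \in B);
    rewrite ?addr0 ?add0r//.
  have : (A `&` B) (xi i w) by split; exact: set_mem.
  by rewrite AB.
- apply: nearW => w; apply: frequency_cvg.
  rewrite (_ : (fun j => _) = cst 1); first exact: cvg_cst.
  apply/funext => j; rewrite /freq /empirical/=.
  rewrite (eq_bigr (fun=> 1)); last by move=> i _; rewrite /hit indicT.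
  by rewrite sumr_const card_ord mulVf// pnatr_eq0 -lt0n.
- move=> A mA; rewrite -EFin_mean; last exact: bm_frequency.
  have := @mean_prod_frequency 1 (fun=> A) (fun=> mA).
  under eq_fun do rewrite big_ord1.
  move=> ->; rewrite fineK ?fin_num_measure//; last first.
    exact: (@measurable_cylinder 1 (fun=> A) (fun=> mA)).
  rewrite /law0 /law/= /distribution/= /pushforward; congr (P _).
  by apply/seteqP; split => w /= => [/(_ ord0)//|Aw i]; rewrite ord1.
Qed.

End limiting_frequencies.

(** * Infinite products of kernel values *)

Section product_of_kernels.
Context {R : realType} d (V : measurableType d) d' (X : measurableType d').
Variable K : V -> probability X R.
Hypothesis measurable_K :
  forall B, measurable B -> measurable_fun setT (fun v => K v B).
Variable A : nat -> set X.
Hypothesis mA : forall i, measurable (A i).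

Let K01 v i : 0 <= fine (K v (A i)) <= 1.
Proof.
by rewrite -!lee_fin fineK ?fin_num_measure// measure_ge0 probability_le1.
Qed.

Lemma prod_kernelE n v :
  (\prod_(i < n) K v (A i) = (\prod_(i < n) fine (K v (A i)))%:E)%E.
Proof.
rewrite -prodEFin; apply: eq_bigr => i _.
by rewrite fineK// fin_num_measure.
Qed.

Lemma prod_kernel01 n v : 0 <= \prod_(i < n) fine (K v (A i)) <= 1.
Proof.
apply/andP; split; first by apply: prodr_ge0 => i _; case/andP: (K01 v i).
by apply: prodr_ile1 => i _; exact: K01.
Qed.

Lemma measurable_prod_kernel n :
  measurable_fun setT (fun v => \prod_(i < n) K v (A i))%E.
Proof.
under eq_fun do rewrite prod_kernelE.
apply/measurable_EFinP.
apply: (@measurable_prod _ _ _ _ _ _ (fun (i : 'I_n) v => fine (K v (A i)))) => i _.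
by apply: measurableT_comp; [exact: fine_measurable|exact: measurable_K].
Qed.

Lemma is_cvg_prod_kernel v : cvgn (fun n => \prod_(i < n) K v (A i))%E.
Proof.
apply: ereal_nonincreasing_is_cvgn; apply/nonincreasing_seqP => n.
rewrite !prod_kernelE lee_fin big_ord_recr/=.
by rewrite ler_piMr//; [case/andP: (prod_kernel01 n v)|case/andP: (K01 v n)].
Qed.

Lemma measurable_lim_prod_kernel :
  measurable_fun setT (fun v => limn (fun n => \prod_(i < n) K v (A i)))%E.
Proof.
apply: (emeasurable_fun_cvg (fun n v => \prod_(i < n) K v (A i))%E) => //.
  exact: measurable_prod_kernel.
by move=> v _; exact: is_cvg_prod_kernel.
Qed.

Lemma lim_prod_kernel_ge0 v :
  (0 <= limn (fun n => \prod_(i < n) K v (A i)))%E.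
Proof.
apply: lime_ge; first exact: is_cvg_prod_kernel.
by apply: nearW => n; rewrite prod_kernelE lee_fin; case/andP: (prod_kernel01 n v).
Qed.

End product_of_kernels.

(** * De Finetti's theorem on coded spaces *)

Section de_finetti.
Context {R : realType} d (Omega : measurableType d) (P : probability Omega R).
Context d' (X : measurableType d') (xi : nat -> Omega -> X).
Hypothesis mxi : forall i, measurable_fun setT (xi i).
Hypothesis exch : forall N (s : 'S_N) (A : 'I_N -> set X),
  (forall i, measurable (A i)) ->
  P [set w | forall i : 'I_N, A i (xi i w)] =
  P [set w | forall i : 'I_N, A i (xi (s i) w)].
Variable c : coding R X.

Definition directing_code (w : Omega) : R :=
  encode (fun k => frequency xi (code_halfline c k) w).

Let K w := universal_kernel c (directing_code w).

Lemma measurable_directing_code : measurable_fun setT directing_code.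
Proof. exact: (measurable_rc_encode (frequency_random_content mxi exch) c). Qed.

Let measurable_K A : measurable A -> measurable_fun setT (fun w => K w A).
Proof.
move=> mA; apply: (measurableT_comp (measurable_universal_kernel c mA)).
exact: measurable_directing_code.
Qed.

Lemma finite_de_finetti (A : nat -> set X) n : (forall i, measurable (A i)) ->
  P [set w | forall i : 'I_n, A i (xi i w)] =
  (\int[P]_w \prod_(i < n) K w (A i))%E.
Proof.
move=> mA; rewrite -[LHS]fineK; last first.
  by rewrite fin_num_measure//; exact: (measurable_cylinder mxi _ mA).
rewrite -(@mean_prod_frequency R _ _ P _ _ xi mxi exch n A mA) EFin_mean; last first.
  by apply: bm_prod => i; exact: bm_frequency.
apply: ae_eq_integral => //.
- apply/measurable_EFinP.
  by apply: measurable_prod => i _; exact: measurable_frequency.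
- exact: (measurable_prod_kernel measurable_K mA).
(* One null set serves all i at once, since the [A i] are countably many. *)
have KF : \forall w \ae P, forall i, K w (A i) = (frequency xi (A i) w)%:E.
  apply: ae_foralln => i.
  exact: (rc_universal_kernel (frequency_random_content mxi exch) c (mA i)).
apply: filterS KF => w KF _; rewrite prod_kernelE//; congr (_%:E).
by apply: eq_bigr => i _; rewrite KF.
Qed.

(** Both sides are limits of the finite identities: continuity from above for the cylinders,
    dominated convergence with bound 1 for the integrals. *)
Theorem de_finetti (A : nat -> set X) : (forall i, measurable (A i)) ->
  P [set w | forall i, A i (xi i w)] =
  (\int[P]_w limn (fun n => \prod_(i < n) K w (A i)))%E.
Proof.
move=> mA; pose B n := [set w | forall i : 'I_n, A i (xi i w)].
have mB n : measurable (B n) by exact: (measurable_cylinder mxi _ mA).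
have BE : [set w | forall i, A i (xi i w)] = \bigcap_n B n.
  apply/seteqP; split => w /= h; first by move=> n _ i; exact: h.
  by move=> i; exact: (h i.+1 I ord_max).
have cvgB : P \o B @ \oo --> P [set w | forall i, A i (xi i w)].
  rewrite BE; apply: nonincreasing_cvg_mu => //.
  - by rewrite (le_lt_trans (probability_le1 P (mB 0%N)))// ltry.
  - exact: bigcapT_measurable.
  apply/nonincreasing_seqP => n; apply/subsetPset => w h i.
  exact: (h (widen_ord (leqnSn n) i)).
have aecvg : {ae P, forall w, setT w ->
    (\prod_(i < n) K w (A i))%E @[n --> \oo] -->
    limn (fun n => \prod_(i < n) K w (A i))%E}.
  by apply: nearW => w _; apply: is_cvg_prod_kernel.
have K1 : {ae P, forall w n, setT w ->
    (`|\prod_(i < n) K w (A i)| <= cst 1 w)%E}.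
  apply: nearW => w n _; rewrite prod_kernelE// lee_fin.
  by case/andP: (prod_kernel01 K mA n w) => h0 h1; rewrite ger0_norm.
have i1 : P.-integrable setT (cst 1%E).
  exact: (bm_integrable P (@bm_cst R _ Omega 1)).
have [_ _ h] := dominated_convergence measurableT
  (measurable_prod_kernel measurable_K mA)
  (measurable_lim_prod_kernel measurable_K mA) aecvg i1 K1.
apply: (cvg_unique _ cvgB) => //.
apply: cvg_trans h; apply: near_eq_cvg; apply: nearW => n.
by rewrite /= finite_de_finetti.
Qed.

End de_finetti.

(** * Spaces with a countable base of cozero sets *)

Section cozero_bases.
Context {R : realType}.

(** This plays the part of a separable metric. Countability reduces open sets to countable unions;
    the continuous functions allow measures of base sets to be approximated by integrals, which is
    all that the weak topology sees. *)
Record cozero_base (T : ptopologicalType) := CozeroBase {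
  cozero_fun : nat -> T -> R ;
  cozero_continuous : forall k, continuous (cozero_fun k) ;
  cozero_refine : forall O x, open O -> O x -> exists2 k,
    0 < cozero_fun k x & [set y | 0 < cozero_fun k y] `<=` O }.

Arguments cozero_continuous {T} _ _ x.
Arguments cozero_refine {T} _ {O x}.

Definition cozero (T : ptopologicalType) (b : cozero_base T) k : set T :=
  [set y | 0 < cozero_fun b k y].

Lemma cozero_open (T : ptopologicalType) (b : cozero_base T) k :
  open (cozero b k).
Proof.
have /continuousP/(_ [set r | 0 < r]) := cozero_continuous b k.
by apply; exact: open_gt.
Qed.

Lemma open_cozeroE (T : ptopologicalType) (b : cozero_base T) (O : set T) :
  open O -> O = \bigcup_(k in [set k | cozero b k `<=` O]) cozero b k.
Proof.
move=> oO; apply/seteqP; split => x; last by move=> [k /= kO xk]; exact: kO.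
by move=> /(cozero_refine b oO)[k xk kO]; exists k.
Qed.

Lemma measurable_open (T : ptopologicalType) (O : set T) :
  open O -> measurable (O : set (borel T)).
Proof. exact: sub_sigma_algebra. Qed.

Lemma measurable_fun_open d (X : measurableType d) (T : ptopologicalType)
    (f : X -> borel T) :
  (forall O : set T, open O -> measurable (f @^-1` O)) -> measurable_fun setT f.
Proof.
move=> mf; apply: (@measurability _ _ X (borel T) setT f (@open T)) => //.
by move=> _ [B oB <-]; rewrite setTI; exact: mf.
Qed.

Lemma measurable_fun_cozero d (X : measurableType d) (T : ptopologicalType)
    (b : cozero_base T) (f : X -> borel T) :
  (forall k, measurable (f @^-1` cozero b k)) -> measurable_fun setT f.
Proof.
move=> mf; apply: measurable_fun_open => O /(open_cozeroE b) ->.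
by rewrite preimage_bigcup; apply: bigcup_measurable => k _; exact: mf.
Qed.

Lemma continuous_measurable_real (T : ptopologicalType) (f : T -> R) :
  continuous f -> measurable_fun [set: borel T] (f : borel T -> R).
Proof.
move=> /continuousP cf; apply: (measurability _ (RGenOInfty.measurableE R)) => //.
move=> _ [_ [a ->] <-]; rewrite setTI; apply: measurable_open.
by apply: cf; exact: interval_open.
Qed.

Lemma measurable_preim_cozero d (X : measurableType d) (f : X -> R) :
  measurable_fun setT f -> measurable [set x | 0 < f x].
Proof. by move=> mf; apply: measurable_ltr_set => //; exact: measurable_cst. Qed.

(** * Codings and bases for row vectors, Borel subsets and products *)

Section row_vectors.
Variable n : nat.

Let center (s : seq rat) : 'rV[R]_n := \row_i ratr (nth 0 s i).

(** Balls of rational centre and radius, presented as cozero sets; nonpositive radii give the empty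
    set. *)
Let ball_fun k (x : 'rV[R]_n) : R :=
  let sr := odflt ([::], 0) (unpickle k : option (seq rat * rat)) in
  ratr sr.2 - `|center sr.1 - x|.

Let ball_fun_continuous k : continuous (ball_fun k).
Proof.
move=> x A /nbhs_ballP[e e0 eA].
apply/nbhs_ballP; exists e => // y; rewrite mx_norm_ball /ball_/= => xy.
apply: eA; rewrite /ball/= /ball_fun; set c := center _.
set r := ratr _; set p := `|c - x|; set q := `|c - y|.
have -> : r - p - (r - q) = q - p by ring.
rewrite (le_lt_trans (ler_dist_dist _ _))//.
by rewrite opprB addrC addrA subrK.
Qed.

Let ball_fun_refine O x : open O -> O x -> exists2 k,
  0 < ball_fun k x & [set y | 0 < ball_fun k y] `<=` O.
Proof.
rewrite openE => /(_ x)/[apply]/nbhs_ballP[e /= e0 eO].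
(* Two points within r of a common centre are then within e of each other. *)
have /rat_in_itvoo[r] : 0 < e / 2 by rewrite divr_gt0.
rewrite in_itv/= => /andP[r0 re].
have /choice[q hq] (i : 'I_n) : exists q : rat, x 0 i < ratr q < x 0 i + ratr r.
  have /rat_in_itvoo[q] : x 0 i < x 0 i + ratr r by rewrite ltrDl.
  by rewrite in_itv/= => ?; exists q.
pose s := [seq q i | i <- enum 'I_n].
have sE (i : 'I_n) : nth 0 s i = q i.
  by rewrite (nth_map i) ?size_enum_ord// nth_ord_enum.
have xc : `|center s - x| < ratr r.
  have : ball (center s) (ratr r) x.
    split => // i j; rewrite (ord1 i) mxE sE /ball/= ltr_distlC.
    by have /andP[? ?] := hq j; apply/andP; split; lra.
  by rewrite mx_norm_ball.
exists (pickle (s, r)); first by rewrite /ball_fun pickleK/= subr_gt0.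
move=> y; rewrite /= /ball_fun pickleK/= subr_gt0 => yc.
apply: eO; rewrite mx_norm_ball /ball_/=.
rewrite (_ : x - y = (center s - y) - (center s - x)); last first.
  by rewrite opprB [RHS]addrC addrA subrK.
by rewrite (le_lt_trans (ler_normB _ _))//; lra.
Qed.

Definition row_cozero_base : cozero_base 'rV[R]_n :=
  CozeroBase ball_fun_continuous ball_fun_refine.

Let row_code (x : borel 'rV[R]_n) : R :=
  encode (fun k => oapp (fun i : 'I_n => x 0 i) 0 (insub k)).

Let row_uncode (z : R) : borel 'rV[R]_n := \row_i decode z i.

Let measurable_row_code : measurable_fun setT row_code.
Proof.
apply: measurable_encode => k; case: (insub k) => [i|] /=.
  by apply: continuous_measurable_real; exact: coord_continuous.
exact: measurable_cst.
Qed.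

Let measurable_row_uncode : measurable_fun setT row_uncode.
Proof.
apply: (measurable_fun_cozero (b := row_cozero_base)) => k.
rewrite /cozero/= /ball_fun; set sr := odflt _ _.
(* The sign test matters for n = 0: the intersection over coordinates is then everything, but a ball
   of nonpositive radius is empty. *)
rewrite (_ : _ @^-1` _ = if 0 < ratr sr.2 :> R then \bigcap_l
    oapp (fun i : 'I_n => [set z | `|center sr.1 0 i - decode z i| < ratr sr.2])
      setT (insub l) else set0); last first.
  apply/seteqP; split => z /=; rewrite subr_gt0.
    move=> h; rewrite (le_lt_trans _ h)// => l _.
    case: insubP => //= i _ _.
    have : ball (center sr.1) (ratr sr.2) (row_uncode z) by rewrite mx_norm_ball.
    by move=> [_ /(_ 0 i)]; rewrite [row_uncode z _ _]mxE.
  case: ifPn => // r0 h.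
  have : ball (center sr.1) (ratr sr.2) (row_uncode z).
    split => // i j; rewrite (ord1 i) [row_uncode z _ _]mxE.
    by have := h (j : nat) I; rewrite valK.
  by rewrite mx_norm_ball.
case: ifPn => // _; apply: bigcapT_measurable => l.
case: insubP => //= i _ _; apply: measurable_ltr_set; last exact: measurable_cst.
apply: measurableT_comp => //; apply: measurable_funB; first exact: measurable_cst.
exact: measurable_decode.
Qed.

Let row_codeKx x : row_uncode (row_code x) = x.
Proof. by apply/rowP => i; rewrite mxE /row_code encodeK valK. Qed.

Let row_codeK A x : measurable A -> A (row_uncode (row_code x)) <-> A x.
Proof. by rewrite row_codeKx. Qed.

Definition row_coding : coding R (borel 'rV[R]_n) :=
  Coding measurable_row_code measurable_row_uncode row_codeK.

Lemma row_uncode_code (x : 'rV[R]_n) :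
  uncode row_coding (code row_coding x) = x.
Proof. exact: row_codeKx. Qed.

End row_vectors.

Section subspaces.
Variables (n : nat) (S : borel_subset R n).
Local Notation T := (space_of S).

Let val_continuous : continuous (val : T -> 'rV[R]_n).
Proof. exact: initial_continuous. Qed.

Let sub_fun k (x : T) : R := cozero_fun (row_cozero_base n) k (val x).

Let sub_fun_continuous k : continuous (sub_fun k).
Proof.
move=> x; apply: (@continuous_comp T 'rV[R]_n R val).
  exact: val_continuous.
exact: cozero_continuous.
Qed.

Let sub_fun_refine O x : open O -> O x -> exists2 k,
  0 < sub_fun k x & [set y | 0 < sub_fun k y] `<=` O.
Proof.
move=> [B oB <-] Bx; have [k xk kB] := cozero_refine (row_cozero_base n) oB Bx.
by exists k => // y /kB.
Qed.

Definition space_cozero_base : cozero_base T :=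
  CozeroBase sub_fun_continuous sub_fun_refine.

Let space_code (x : borel T) : R := code (row_coding n) (val (x : T)).

(** Reals whose row falls outside the subset go to the base point; measurability of this case split
    is where [bs_borel] is used. *)
Let space_uncode (z : R) : borel T :=
  if pselect (bs_set S (uncode (row_coding n) z)) is left h
  then exist (fun x => x \in bs_set S) _ (mem_set h) : T else point.

Let measurable_space_code : measurable_fun setT space_code.
Proof.
apply: (@measurableT_comp _ _ _ _ _ _ (code (row_coding n)) _
  (val : borel T -> borel 'rV[R]_n)); first exact: measurable_code.
exact: (@measurable_continuous T 'rV[R]_n).
Qed.

Let measurable_space_uncode : measurable_fun setT space_uncode.
Proof.
apply: (measurable_fun_cozero (b := space_cozero_base)) => k.
pose V : set R := uncode (row_coding n) @^-1` bs_set S.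
pose W : set R := uncode (row_coding n) @^-1` cozero (row_cozero_base n) k.
have mV : measurable V.
  rewrite -[X in measurable X]setTI; apply: measurable_uncode => //.
  exact: bs_borel.
have mW : measurable W.
  rewrite -[X in measurable X]setTI; apply: measurable_uncode => //.
  by apply: measurable_open; exact: cozero_open.
have [p|p] := pselect (0 < sub_fun k point).
  rewrite (_ : _ @^-1` _ = (V `&` W) `|` ~` V).
    by apply: measurableU; [exact: measurableI|exact: measurableC].
  apply/seteqP; split => z; rewrite /preimage/= /cozero/= /space_uncode.
    by case: pselect => [h /= w|h _]; [left|right].
  by case: pselect => [h /= [[_ w]|nV]|h _].
rewrite (_ : _ @^-1` _ = V `&` W); first exact: measurableI.
apply/seteqP; split => z; rewrite /preimage/= /cozero/= /space_uncode.
  by case: pselect => [h /= w|h].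
by case: pselect => [h /= [_ w]|h []].
Qed.

Let space_codeKx (x : T) : space_uncode (space_code x) = x.
Proof.
rewrite /space_uncode; case: pselect => [h|h]; last first.
  by exfalso; apply: h; rewrite row_uncode_code; exact: set_mem (valP x).
by apply: val_inj => /=; exact: row_uncode_code.
Qed.

Let space_codeK A x : measurable A -> A (space_uncode (space_code x)) <-> A x.
Proof. by rewrite space_codeKx. Qed.

Definition space_coding : coding R (borel T) :=
  Coding measurable_space_code measurable_space_uncode space_codeK.

Lemma space_uncode_code (x : T) : uncode space_coding (code space_coding x) = x.
Proof. exact: space_codeKx. Qed.

End subspaces.

Section products.
Variables (U Y : ptopologicalType).
Variables (bU : cozero_base U) (bY : cozero_base Y).

Let pair_fun k (x : U * Y) : R :=
  let ij := odflt (0, 0)%N (unpickle k) in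
  Num.min (cozero_fun bU ij.1 x.1) (cozero_fun bY ij.2 x.2).

Let pair_fun_continuous k : continuous (pair_fun k).
Proof.
move=> x; apply: (@continuous_min R (U * Y)%type).
  apply: continuous_comp; first exact: cvg_fst.
  exact: cozero_continuous.
apply: continuous_comp; first exact: cvg_snd.
exact: cozero_continuous.
Qed.

Let pair_fun_refine (O : set (U * Y)%type) x : open O -> O x -> exists2 k,
  0 < pair_fun k x & [set y | 0 < pair_fun k y] `<=` O.
Proof.
rewrite openE => /(_ x)/[apply] -[[A B] /= [Ax Bx] AB].
move: Ax Bx; rewrite /= !nbhsE => -[A' [oA' A'x] A'A] [B' [oB' B'x] B'B].
have [i xi iA] := cozero_refine bU oA' A'x.
have [j xj jB] := cozero_refine bY oB' B'x.
exists (pickle (i, j)); first by rewrite /pair_fun pickleK/= lt_min xi.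
move=> [u y]; rewrite /= /pair_fun pickleK/= lt_min => /andP[ui yj].
by apply: AB; split => /=; [exact/A'A/iA|exact/B'B/jB].
Qed.

Definition pair_cozero_base : cozero_base (U * Y)%type :=
  CozeroBase pair_fun_continuous pair_fun_refine.

Lemma measurable_fst_borel :
  measurable_fun setT (fst : borel (U * Y)%type -> borel U).
Proof. by apply: (@measurable_continuous (U * Y)%type) => x; exact: cvg_fst. Qed.

Lemma measurable_snd_borel :
  measurable_fun setT (snd : borel (U * Y)%type -> borel Y).
Proof. by apply: (@measurable_continuous (U * Y)%type) => x; exact: cvg_snd. Qed.

(** The countable base is essential here: open sets of the product are countable unions of open
    rectangles, so the Borel sets of the product topology need only the two components. *)
Lemma measurable_pair_borel d (X : measurableType d) (f : X -> borel U)
    (g : X -> borel Y) :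
  measurable_fun setT f -> measurable_fun setT g ->
  measurable_fun setT (fun x => (f x, g x) : borel (U * Y)%type).
Proof.
move=> mf mg; apply: (measurable_fun_cozero (b := pair_cozero_base)) => k.
rewrite /cozero/= /pair_fun.
pose ij := odflt (0, 0)%N (unpickle k : option (nat * nat)).
rewrite (_ : _ @^-1` _ =
    f @^-1` cozero bU ij.1 `&` g @^-1` cozero bY ij.2); last first.
  by apply/seteqP; split => x; rewrite /preimage/= /cozero/= lt_min => /andP.
apply: measurableI; rewrite -[X in measurable X]setTI; [apply: mf|apply: mg] => //;
  apply: measurable_open; exact: cozero_open.
Qed.

Variables (cU : coding R (borel U)) (cY : coding R (borel Y)).
Hypothesis cUK : forall u, uncode cU (code cU u) = u.
Hypothesis cYK : forall y, uncode cY (code cY y) = y.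

Let pair_code (x : borel (U * Y)%type) : R :=
  encode (fun k => if k == 0%N then code cU x.1 else code cY x.2).

Let pair_uncode (z : R) : borel (U * Y)%type :=
  (uncode cU (decode z 0), uncode cY (decode z 1)).

Let measurable_pair_code : measurable_fun setT pair_code.
Proof.
apply: measurable_encode => k; have [_|_] := eqVneq k 0%N; rewrite /=.
  exact: measurableT_comp (measurable_code cU) measurable_fst_borel.
exact: measurableT_comp (measurable_code cY) measurable_snd_borel.
Qed.

Let measurable_pair_uncode : measurable_fun setT pair_uncode.
Proof.
apply: measurable_pair_borel;
  (apply: measurableT_comp; [exact: measurable_uncode|exact: measurable_decode]).
Qed.

Let pair_codeK A x : measurable A -> A (pair_uncode (pair_code x)) <-> A x.
Proof.
have -> : pair_uncode (pair_code x) = x; last by [].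
by case: x => u y; rewrite /pair_uncode /pair_code !encodeK/= cUK cYK.
Qed.

Definition pair_coding : coding R (borel (U * Y)%type) :=
  Coding measurable_pair_code measurable_pair_uncode pair_codeK.

End products.

End cozero_bases.
Arguments cozero_base R T : clear implicits.

(** * The weak topology *)

(** With [level_sum_ge], a discrete layer cake: the number of integers from 1 to n strictly below y
    differs from y by at most 1 when 0 <= y <= n + 1. *)
Lemma level_sum_le {R : realType} n (y : R) : 0 <= y ->
  \sum_(i < n) (i.+1%:R < y)%R%:R <= y.
Proof.
move=> y0; elim: n => [|n IH]; first by rewrite big_ord0.
rewrite big_ord_recr/=; have [ny|_] := ltP; last by rewrite addr0.
apply: le_trans (ltW ny); rewrite -natr1 lerD2r.
apply: (@le_trans _ _ (\sum_(i < n) 1)); last by rewrite sumr_const card_ord.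
by apply: ler_sum => i _; case: (_ < y).
Qed.

Lemma level_sum_ge {R : realType} n (y : R) : y <= n.+1%:R ->
  y <= 1 + \sum_(i < n) (i.+1%:R < y)%R%:R.
Proof.
elim: n => [|n IH] yn; first by rewrite big_ord0 addr0.
have [ny|ny] := ltP n.+1%:R y; last first.
  rewrite big_ord_recr/= (le_trans (IH ny))// lerD2l lerDl.
  by case: (_ < y).
rewrite (eq_bigr (fun=> 1)) => [|i _].
  by rewrite sumr_const card_ord addrC natr1.
rewrite (_ : _ < y) // (le_lt_trans _ ny)// ler_nat.
exact: ltn_ord.
Qed.

Section weak_topology.
Context {R : realType} (T : ptopologicalType) (b : cozero_base R T).

Local Notation prb := (prob R T).

Definition cozeros (s : seq nat) : set T := \bigcup_(k in [set` s]) cozero b k.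

(** Lower bounds on open sets, as in the portmanteau theorem. The lists range over a countable type,
    so these sets form a countable family; what matters is that every weakly open set is a union of
    them. *)
Definition weak_basic (l : seq (seq nat * rat)) : set prb :=
  [set nu : probability (borel T) R |
    forall sq, sq \in l -> ((ratr sq.2)%:E < nu (cozeros sq.1))%E].

Lemma open_cozeros s : open (cozeros s).
Proof. by apply: bigcup_open => k _; exact: cozero_open. Qed.

Lemma measurable_cozeros s : measurable (cozeros s : set (borel T)).
Proof. by apply: measurable_open; exact: open_cozeros. Qed.

Lemma open_cozeros_approx (mu : probability (borel T) R) (O : set T) (e : R) :
  open O -> 0 < e -> exists2 s, cozeros s `<=` O &
    (mu O - e%:E < mu (cozeros s))%E.
Proof.
move=> oO e0.
pose s n := [seq k <- iota 0 n | `[< cozero b k `<=` O >]].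
have sO n : cozeros (s n) `<=` O.
  move=> x [k /=]; rewrite mem_filter => /andP[/asboolP kO _]; exact: kO.
have OE : O = \bigcup_n cozeros (s n).
  apply/seteqP; split; last by move=> x [n _]; exact: sO.
  rewrite {1}(open_cozeroE b oO) => x [k /= kO xk]; exists k.+1 => //.
  exists k => //=; rewrite mem_filter mem_iota/= add0n ltnS leqnn andbT.
  exact/asboolP.
have mO : measurable (O : set (borel T)) by exact: measurable_open.
have : (mu \o (fun n => cozeros (s n))) n @[n --> \oo] --> mu O.
  rewrite {1}OE; apply: nondecreasing_cvg_mu.
  - by move=> n; exact: measurable_cozeros.
  - by rewrite -OE.
  apply/nondecreasing_seqP => n; apply/subsetPset => x [k /= ks xk].
  exists k => //=; move: ks; rewrite !mem_filter !mem_iota/= !add0n.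
  by case/andP => -> /= /leqW.
rewrite -(fineK (fin_num_measure mu _ mO)) => /fine_cvgP[_].
move=> /(@cvgrPdist_lt _ R^o)/(_ _ e0)[n _ /(_ n (leqnn n))] /= h.
exists (s n) => //.
rewrite -(fineK (fin_num_measure mu _ (measurable_cozeros (s n)))) lte_fin.
by move: h; rewrite ltr_distlC => /andP[].
Qed.

Let bm_continuous (f : T -> R) : bounded_continuous f ->
  @bounded_measurable R _ (borel T) f.
Proof.
by move=> [cf [M fM]]; split; [exact: continuous_measurable_real|exists M].
Qed.

(* Layer cake: the integral of [g] is within [1 / n] of the average over [i] of
   the measures of the open sets [i.+1 / n < g]. *)
Lemma weak_basic_lsc (mu : probability (borel T) R) (g : T -> R) (e : R) :
  continuous g -> (forall x, 0 <= g x <= 1) -> 0 < e ->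
  exists2 l, weak_basic l mu &
    forall nu : probability (borel T) R, weak_basic l nu ->
      mean mu g - e < mean nu g.
Proof.
move=> cg g01 e0.
(* Error budget: e / 2 for the layer cake, whose error is 1 / n, and e / 2 for the loss on the
   measure of each level set. *)
have [m me] : exists m, m.+1%:R^-1 < e / 2 by apply: invS_lt; rewrite divr_gt0.
pose n := m.+1; have n0 : 0 < n%:R :> R by rewrite ltr0n.
have e2 : 0 < e / 2 by rewrite divr_gt0.
pose U (i : nat) : set (borel T) := [set x | i.+1%:R < n%:R * g x].
have oU i : open (U i : set T).
  rewrite (_ : U i = g @^-1` [set r | n%:R^-1 * i.+1%:R < r]); last first.
    by apply/seteqP; split => x; rewrite /U/= ltr_pdivrMl.
  by move/continuousP: cg; apply; exact: open_gt.
have mU i : measurable (U i) by exact: measurable_open.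
have /choice[s /all_and2[sU sE]] : forall i, exists s, cozeros s `<=` U i /\
    (mu (U i) - (e / 2)%:E < mu (cozeros s))%E.
  by move=> i; have [s ? ?] := open_cozeros_approx mu (oU i) e2; exists s.
have finU (nu : probability (borel T) R) i : nu (U i) = (fine (nu (U i)))%:E.
  by rewrite fineK// fin_num_measure.
have finS (nu : probability (borel T) R) t :
    nu (cozeros t) = (fine (nu (cozeros t)))%:E.
  by rewrite fineK// fin_num_measure//; exact: measurable_cozeros.
have /choice[q /all_and2[qU qS]] : forall i, exists q : rat,
    fine (mu (U i)) - e / 2 < ratr q /\ ((ratr q)%:E < mu (cozeros (s i)))%E.
  move=> i; have := sE i; rewrite finU finS lte_fin => /rat_in_itvoo[q].
  by rewrite in_itv/= => /andP[? ?]; exists q; rewrite lte_fin.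
have bg : @bounded_measurable R _ (borel T) g.
  split; first exact: continuous_measurable_real.
  by exists 1 => x; case/andP: (g01 x) => ? ?; rewrite ger0_norm.
have bU i : @bounded_measurable R _ (borel T) \1_(U i) by exact: bm_indic.
have levelE (x : T) :
    \sum_(i < n) (i.+1%:R < n%:R * g x)%R%:R = \sum_(i < n) \1_(U i) x :> R.
  apply: eq_bigr => i _; rewrite indicE; congr (nat_of_bool _)%:R.
  by apply/idP/idP => [h|/set_mem//]; exact: mem_set.
have lower (nu : probability (borel T) R) :
    \sum_(i < n) fine (nu (U i)) <= n%:R * mean nu g.
  under eq_bigr do rewrite -mean_indic//.
  rewrite -mean_sum// -meanZ//; apply: le_mean => [||x].
  - exact: bm_sum.
  - exact: bmZ.
  rewrite -levelE; apply: level_sum_le; apply: mulr_ge0; first exact: ltW.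
  by case/andP: (g01 x).
have upper (nu : probability (borel T) R) :
    n%:R * mean nu g <= 1 + \sum_(i < n) fine (nu (U i)).
  under eq_bigr do rewrite -mean_indic//.
  rewrite -mean_sum// -meanZ// -[X in _ <= X + _](mean_cst nu 1).
  rewrite -meanD//; last 2 first.
  - exact: bm_cst.
  - exact: bm_sum.
  apply: le_mean => [||x].
  - exact: bmZ.
  - by apply: bmD; [exact: bm_cst|exact: bm_sum].
  rewrite -levelE; apply: level_sum_ge.
  case/andP: (g01 x) => _ g1; apply: (@le_trans _ _ n%:R).
    by rewrite ler_piMr// ltW.
  by rewrite ler_nat.
exists [seq (s i, q i) | i <- iota 0 n].
  by move=> _ /mapP[i _ ->]; exact: qS.
move=> nu nul.
have nuU i : (i < n)%N -> fine (mu (U i)) - e / 2 < fine (nu (U i)).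
  move=> im; apply: (lt_trans (qU i)); rewrite -lte_fin -finU.
  apply: (@lt_le_trans _ _ (nu (cozeros (s i)))).
    by apply: (nul (s i, q i)); apply/mapP; exists i => //; rewrite mem_iota.
  by apply: le_measure; rewrite ?inE//; exact: measurable_cozeros.
have h1 := upper mu; have h2 := lower nu.
have h3 : \sum_(i < n) (fine (mu (U i)) - e / 2) <= \sum_(i < n) fine (nu (U i)).
  by apply: ler_sum => i _; exact/ltW/nuU.
rewrite sumrB sumr_const card_ord -[_ *+ n]mulr_natl in h3.
have me' : 1 < n%:R * (e / 2) by rewrite -ltr_pdivrMl// mulr1.
rewrite -(ltr_pM2l n0) mulrBr.
have -> : n%:R * e = n%:R * (e / 2) + n%:R * (e / 2).
  by rewrite -mulrDr; congr (_ * _); field.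
by move: (\sum_(i < n) _) (\sum_(i < n) _) h1 h2 h3 => S1 S2; lra.
Qed.

Let weak_filter (mu : prb) : set_system prb :=
  filter_from [set l | weak_basic l mu] weak_basic.

Let weak_filter_filter mu : Filter (weak_filter mu).
Proof.
apply: filter_from_filter; first by exists [::].
move=> l1 l2 l1mu l2mu; exists (l1 ++ l2) => /=.
  by move=> sq; rewrite mem_cat => /orP[]; [exact: l1mu|exact: l2mu].
by move=> nu h; split => sq sql; apply: h; rewrite mem_cat sql ?orbT.
Qed.

(** The sets [weak_basic] around [mu] generate a filter, and it suffices that integrals converge
    along it. [weak_basic_lsc] only bounds them from below; applied to the opposite function it also
    bounds them from above. *)
Lemma weak_basic_refine (O : set prb) (mu : prb) : open O -> O mu ->
  exists2 l, weak_basic l mu & weak_basic l `<=` O.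
Proof.
move=> [B oB <-] Bmu.
have FF := weak_filter_filter mu.
suff cvg : @integral_against R T @ weak_filter mu --> integral_against mu.
  exact: (cvg B (open_nbhs_nbhs (conj oB Bmu))).
suff pw (f : set_type (@bounded_continuous R T)) :
    (fun g : set_type (@bounded_continuous R T) -> R => g f) @
      (@integral_against R T @ weak_filter mu) --> integral_against mu f.
  apply/cvg_sup => f; apply/cvg_image.
    by rewrite eqEsubset; split => // r _; exists (fun=> r).
  move=> W /(pw f) fW; exists ((fun g => g f) @^-1` W) => //.
  by rewrite eqEsubset; split => [_ [g + <-]//|r Wr]; exists (fun=> r).
have bf : bounded_continuous (set_val f) by exact: set_valP.
have [cf [M0 fM0]] := bf; pose M : R := `|M0| + 1.
have M_gt0 : 0 < M by rewrite ltr_wpDl.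
have fM x : `|set_val f x| <= M.
  by rewrite (le_trans (fM0 x))// (le_trans (ler_norm _))// lerDl.
have lsc h : bounded_continuous h -> (forall x, `|h x| <= M) ->
    forall e : R, 0 < e -> \forall nu \near weak_filter mu,
      mean (mu : probability (borel T) R) h - e <
      mean (nu : probability (borel T) R) h.
  (* An affine change of scale from [-M, M] to [0, 1], under which the tolerance e becomes e / (2
     M). *)
  move=> bh hM e e0; pose g x := (2 * M)^-1 * (h x + M).
  have M2 : 0 < 2 * M by rewrite mulr_gt0.
  have cg : continuous g.
    move=> x; apply: cvgMr; apply: cvgD; last exact: cvg_cst.
    exact: bh.1.
  have g01 x : 0 <= g x <= 1.
    have [h1 h2] : - M <= h x /\ h x <= M.
      by apply/andP; rewrite -ler_norml.
    apply/andP; split; last by rewrite /g ler_pdivrMl// mulr1; lra.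
    by apply: mulr_ge0; [rewrite invr_ge0 ltW|lra].
  have [l lmu lg] := weak_basic_lsc mu cg g01 (divr_gt0 e0 M2).
  exists l => // nu /lg.
  have gE (P : probability (borel T) R) : mean P g = (2 * M)^-1 * (mean P h + M).
    rewrite -[X in _ + X](mean_cst P M) -meanD; [|exact: bm_continuous|exact: bm_cst].
    rewrite -meanZ; first by [].
    by apply: bmD; [exact: bm_continuous|exact: bm_cst].
  rewrite !gE [e / _]mulrC -mulrBr ltr_pM2l ?invr_gt0//; lra.
have fM' x : `|- set_val f x| <= M by rewrite normrN.
have bNf : bounded_continuous (fun x => - set_val f x).
  split; last by exists M.
  by move=> x; apply: cvgN; exact: cf.
have meanN (P : probability (borel T) R) :
    mean P (fun x => - set_val f x) = - mean P (set_val f).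
  rewrite -mulN1r -meanZ; last exact: bm_continuous.
  by congr mean; apply/funext => x; rewrite mulN1r.
apply/(@cvgrPdist_lt _ R^o) => e e0.
have := lsc _ bf fM e e0; have := lsc _ bNf fM' e e0.
apply: filterS2 => nu; rewrite !meanN => h1 h2.
rewrite /preimage/= ltr_distlC /integral_against -/(mean mu (set_val f)).
rewrite -/(mean nu (set_val f)); apply/andP; split; first exact: h2.
by move: h1; rewrite ltrNr opprD !opprK.
Qed.

(** An open set is the union of the countably many sets [weak_basic] it contains, each a finite
    conjunction of bounds on evaluations. *)
Lemma measurable_fun_weak d (X : measurableType d) (F : X -> prb) (O : set prb) :
  (forall A : set (borel T), measurable A -> measurable_fun setT
    (fun x => (F x : probability (borel T) R) A)) ->
  open O -> measurable (F @^-1` O).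
Proof.
move=> mF oO.
have [dec decK] : exists dec : nat -> option (seq (seq nat * rat)),
    forall l, dec (pickle l) = Some l by exists unpickle; exact: pickleK.
rewrite (_ : F @^-1` O = \bigcup_k (if dec k is Some l then
    if `[< weak_basic l `<=` O >] then F @^-1` weak_basic l else set0
    else set0)); last first.
  apply/seteqP; split => [x Ox|x [k _]]; last first.
    by case: (dec k) => // l; case: asboolP => // lO; exact: lO.
  have [l lx lO] := weak_basic_refine oO Ox; exists (pickle l) => //.
  by rewrite decK asboolT.
apply: bigcupT_measurable => k; case: (dec k) => // l; case: asboolP => // _.
elim: l => [|sq l IH].
  by rewrite (_ : _ @^-1` _ = setT)//; apply/seteqP; split => // x _ sq.
rewrite (_ : _ @^-1` _ = F @^-1` weak_basic l `&`
    [set x | ((ratr sq.2)%:E <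
              (F x : probability (borel T) R) (cozeros sq.1))%E]).
  apply: measurableI => //; rewrite -[X in measurable X]setTI.
  apply: emeasurable_fun_o_infty => //; apply: mF; exact: measurable_cozeros.
apply/seteqP; split => x /=.
  move=> h; split; last by apply: h; rewrite mem_head.
  by move=> sq' sq'l; apply: h; rewrite in_cons sq'l orbT.
by move=> [h1 h2] sq'; rewrite in_cons => /predU1P[->|/h1].
Qed.

Lemma cozero_sets_generate :
  @measurable _ (borel T) =
  <<s [set [set x | 0 < g x] | g in [set g : T -> R | continuous g]] >>.
Proof.
apply/seteqP; split.
  apply: smallest_sub; first exact: smallest_sigma_algebra.
  move=> O oO; rewrite (open_cozeroE b oO).
  pose G := g_sigma_algebraType
    [set [set x | 0 < g x] | g in [set g : T -> R | continuous g]].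
  apply: (@bigcup_measurable _ G) => k _; apply: sub_sigma_algebra.
  exists (cozero_fun b k) => //; exact: cozero_continuous.
apply: smallest_sub; first exact: smallest_sigma_algebra.
move=> _ [g cg <-]; apply: sub_sigma_algebra.
by move/continuousP : cg => /(_ [set r | 0 < r]); apply; exact: open_gt.
Qed.

(** Cozero sets generate the Borel sets and are stable under intersection, by taking minima. On a
    cozero set the evaluation is the limit of the integrals of the truncations of n g to [0, 1],
    which are weakly continuous in the measure. *)
Lemma measurable_prob_eval (A : set (borel T)) : measurable A ->
  measurable_fun [set: borel prb]
    (fun mu : borel prb => (mu : probability (borel T) R) A).
Proof.
pose ev (mu : borel prb) : probability (borel T) R := mu.
move: A; apply: (probability_familyP (P := ev) cozero_sets_generate).
  move=> _ _ [f cf <-] [g cg <-]; exists (fun x => Num.min (f x) (g x)).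
    by move=> x; apply: continuous_min; [exact: cf|exact: cg].
  by apply/seteqP; split => x /=; rewrite lt_min => /andP.
move=> _ [g cg <-].
pose h n x := Num.min (Num.max (n%:R * g x) 0) 1.
have h01 n x : 0 <= h n x <= 1.
  by rewrite /h le_min le_max lexx orbT ler01 ge_min lexx orbT.
have bh n : bounded_continuous (h n).
  split; last by exists 1 => x; case/andP: (h01 n x) => *; rewrite ger0_norm.
  move=> x.
  apply: (@continuous_min R T (fun x => Num.max (n%:R * g x) 0) (cst 1)).
    apply: (@continuous_max R T (fun x => n%:R * g x) (cst 0)).
      by apply: cvgMr; exact: cg.
    exact: cst_continuous.
  exact: cst_continuous.
apply: (emeasurable_fun_cvg (fun n (mu : borel prb) => (mean (ev mu) (h n))%:E)).
  move=> n; apply/measurable_EFinP; apply: continuous_measurable_real.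
  pose hn : set_type (@bounded_continuous R T) :=
    exist (fun f => f \in @bounded_continuous R T) _ (mem_set (bh n)).
  have cproj : continuous ((fun p => p hn) :
      {ptws set_type (@bounded_continuous R T) -> R} -> R).
    exact: (@proj_continuous (set_type (@bounded_continuous R T)) (fun=> R) hn).
  have cint : continuous (@integral_against R T : prb ->
      {ptws set_type (@bounded_continuous R T) -> R}).
    exact: initial_continuous.
  move=> mu; exact: (continuous_comp (cint mu) (cproj _)).
move=> mu _.
have mg : measurable ([set x | 0 < g x] : set (borel T)).
  by apply: measurable_preim_cozero; exact: continuous_measurable_real.
have gE : ev mu [set x | 0 < g x] = (mean (ev mu) \1_[set x | 0 < g x])%:E.
  by rewrite mean_indic// fineK// fin_num_measure.
rewrite -/(ev mu) gE.
have bi : @bounded_measurable R _ (borel T) \1_[set x | 0 < g x] by exact: bm_indic.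
have hc x : h n x @[n --> \oo] --> (\1_[set x | 0 < g x] x : R).
  rewrite indicE; have [gx|gx] := ltP 0 (g x); last first.
    rewrite memNset/=; last by rewrite /= ltNge gx.
    rewrite (_ : (fun n => _) = cst 0); first exact: cvg_cst.
    apply/funext => n; rewrite /h max_r ?min_l//.
    by rewrite mulr_ge0_le0.
  rewrite mem_set//=.
  apply: cvg_near_cst; near=> n; rewrite /h min_r// le_max; apply/orP; left.
  rewrite -ler_pdivrMr// mul1r; near: n; exact: nbhs_infty_ger.
have mh n : measurable_fun setT (fun x : borel T => (h n x)%:E).
  by apply/measurable_EFinP; case: (bm_continuous (bh n)).
have ah : {ae (ev mu), forall x : borel T, setT x ->
    (h n x)%:E @[n --> \oo] --> (\1_[set x | 0 < g x] x)%:E}.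
  apply: nearW => x _; apply: cvg_EFin; first exact: nearW.
  exact: hc.
have h1 : {ae (ev mu), forall (x : borel T) n, setT x ->
    (`|(h n x)%:E| <= cst 1 x)%E}.
  apply: nearW => x n _; rewrite lee_fin.
  by case/andP: (h01 n x) => *; rewrite ger0_norm.
have i1 : (ev mu).-integrable setT (cst 1%E).
  exact: (bm_integrable _ (@bm_cst R _ (borel T) 1)).
have [_ _] := dominated_convergence measurableT mh
  ((measurable_EFinP _ _).2 bi.1) ah i1 h1.
rewrite (EFin_mean _ bi); apply: cvg_trans; apply: near_eq_cvg; apply: nearW => n.
by rewrite EFin_mean//; exact: bm_continuous.
Unshelve. all: by end_near. Qed.

End weak_topology.

(** * Disintegration *)

Section kernel_of_family.
Context {R : realType} d d' (X : measurableType d) (Y : measurableType d').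
Variable P : X -> probability Y R.
Hypothesis mP : forall A, measurable A -> measurable_fun setT (fun x => P x A).

(** The proof of measurability is an argument so that the kernel structures can be attached to
    [pker_of mP]. *)
Definition pker_of & (forall A, measurable A ->
    measurable_fun setT (fun x => P x A)) : X -> {measure set Y -> \bar R} := P.

HB.instance Definition _ := isKernel.Build _ _ X Y R (pker_of mP) mP.

Let pker_of_setT x : pker_of mP x [set: Y] = 1%E.
Proof. exact: probability_setT. Qed.

HB.instance Definition _ :=
  Kernel_isProbability.Build _ _ X Y R (pker_of mP) pker_of_setT.

End kernel_of_family.

Section slices.
Context {R : realType} (U Y : ptopologicalType).
Variable P : probability (borel (U * Y)%type) R.

Definition rectangle (A : set (borel U)) (B : set (borel Y)) :
  set (borel (U * Y)%type) := A `*` B.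

Lemma measurable_rectangle A B :
  measurable A -> measurable B -> measurable (rectangle A B).
Proof.
move=> mA mB.
have m1 := @measurable_fst_borel U Y measurableT A mA.
have m2 := @measurable_snd_borel U Y measurableT B mB.
by have := measurableI _ _ m1 m2; rewrite !setTI.
Qed.

Section slice.
Variable A : set (borel U).
Hypothesis mA : measurable A.

Definition slice & measurable A := fun B => P (rectangle A B).

Let slice0 : slice mA set0 = 0%E.
Proof.
rewrite /slice (_ : rectangle _ _ = set0) ?measure0//.
by apply/seteqP; split => // x [].
Qed.

Let slice_ge0 B : (0 <= slice mA B)%E. Proof. exact: measure_ge0. Qed.

Let slice_sigma_additive : semi_sigma_additive (slice mA).
Proof.
move=> F mF tF mUF; rewrite /slice.
have -> : rectangle A (\bigcup_n F n) = \bigcup_n rectangle A (F n).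
  apply/seteqP; split => [x [Ax [n _ Fx]]|x [n _ [Ax Fx]]]; first by exists n.
  by split => //; exists n.
apply: measure_semi_sigma_additive.
- by move=> n; exact: measurable_rectangle.
- move=> i j _ _ [x [[_ Fi] [_ Fj]]]; apply: tF => //.
  by exists x.2.
- by apply: bigcup_measurable => n _; exact: measurable_rectangle.
Qed.

HB.instance Definition _ := isMeasure.Build _ _ _ (slice mA)
  slice0 slice_ge0 slice_sigma_additive.

Let slice_fin : fin_num_fun (slice mA).
Proof. by move=> B mB; apply: fin_num_measure; exact: measurable_rectangle. Qed.

HB.instance Definition _ := Measure_isFinite.Build _ _ _ (slice mA) slice_fin.

End slice.

Variable Q : probability (borel Y) R.
Hypothesis marginal : forall B, measurable B -> P (rectangle setT B) = Q B.

(** The measure of a rectangle over B is at most Q B, so each slice is dominated by [Q] and has a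
    Radon-Nikodym density. *)
Lemma slice_density A : measurable A -> exists f : borel Y -> R,
  [/\ measurable_fun setT f, forall y, 0 <= f y &
      forall B, measurable B ->
        P (rectangle A B) = (\int[Q]_(y in B) (f y)%:E)%E].
Proof.
move=> mA.
have dom : slice mA `<< Q.
  apply/null_content_dominatesP => B mB QB0; apply/eqP.
  rewrite eq_le measure_ge0 andbT.
  have <- : P (rectangle setT B) = 0%E by rewrite marginal.
  apply: le_measure; rewrite ?inE; [exact: measurable_rectangle..|].
  by move=> x [].
pose g := Radon_Nikodym_SigmaFinite.f (slice mA) Q.
have gfin y : g y \is a fin_num by exact: Radon_Nikodym_SigmaFinite.f_fin_num.
exists (fine \o g); split.
- apply: measurableT_comp; first exact: fine_measurable.
  exact: measurable_int (Radon_Nikodym_SigmaFinite.f_integrable dom).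
- by move=> y; apply: fine_ge0; exact: Radon_Nikodym_SigmaFinite.f_ge0.
- move=> B mB.
  apply: (etrans (Radon_Nikodym_SigmaFinite.f_integral dom mB)).
  apply: eq_integral => y _.
  by rewrite /= fineK.
Qed.

End slices.

Section disintegration.
Context {R : realType} (U Y : ptopologicalType).
Variables (bU : cozero_base R U) (bY : cozero_base R Y).
Variable cU : coding R (borel U).
Variable P : probability (borel (U * Y)%type) R.
Variable Q : probability (borel Y) R.
Hypothesis marginal : forall B, measurable B -> P (rectangle setT B) = Q B.

Let f (A : set (borel U)) : borel Y -> R :=
  if pselect (measurable A) is left mA
  then sval (cid (slice_density marginal mA)) else cst 0.

Let mf A : measurable A -> measurable_fun setT (f A).
Proof. by rewrite /f; case: pselect => // mA _; case: cid => g []. Qed.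

Let f_ge0 A y : 0 <= f A y.
Proof. by rewrite /f; case: pselect => // mA; case: cid => g []. Qed.

Let f_integral A B : measurable A -> measurable B ->
  P (rectangle A B) = (\int[Q]_(y in B) (f A y)%:E)%E.
Proof.
by rewrite /f; case: pselect => // mA _; case: cid => g [? ? h]; exact: h.
Qed.

Let f_integrable A : measurable A -> Q.-integrable setT (EFin \o f A).
Proof.
move=> mA; apply/integrableP; split; first by apply/measurable_EFinP; exact: (mf mA).
under eq_integral => y _ do rewrite /= ger0_norm ?f_ge0//.
rewrite -f_integral//; apply: (le_lt_trans (probability_le1 _ _)); last exact: ltry.
exact: measurable_rectangle.
Qed.

Let lawU : probability (borel U) R := law P (@measurable_fst_borel U Y).

(** The densities are chosen separately for each set; additivity and normalisation hold almost
    everywhere because a density is determined by its integrals. *)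
Let f_random_content : random_content Q lawU f.
Proof.
have ae_eqP g h : Q.-integrable setT (EFin \o g) ->
    measurable_fun setT (EFin \o h) ->
    (forall B, measurable B ->
      \int[Q]_(y in B) (g y)%:E = \int[Q]_(y in B) (h y)%:E)%E ->
    \forall y \ae Q, g y = h y.
  move=> ig mh gh.
  have := integral_ae_eq measurableT ig mh (fun B _ mB => gh B mB).
  by apply: filterS => y /(_ I)[].
split.
- exact: mf.
- by [].
- move=> A B mA mB AB; have mAB := measurableU _ _ mA mB.
  apply: ae_eqP; first exact: f_integrable.
    by apply/measurable_EFinP; apply: measurable_funD; exact: mf.
  move=> C mC; rewrite -f_integral//.
  under [RHS]eq_integral do rewrite EFinD.
  rewrite ge0_integralD//; last 4 first.
  - by move=> y _; rewrite lee_fin f_ge0.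
  - by apply: measurable_funTS; apply/measurable_EFinP; exact: (mf mA).
  - by move=> y _; rewrite lee_fin f_ge0.
  - by apply: measurable_funTS; apply/measurable_EFinP; exact: (mf mB).
  rewrite -!f_integral// -measureU//; try exact: measurable_rectangle.
    congr (P _); apply/seteqP; split => x.
      by move=> [[Ax|Bx] Cx]; [left|right].
    by move=> [[Ax Cx]|[Bx Cx]]; split => //; [left|right].
  apply/seteqP; split => // x [[Ax _] [Bx _]].
  by have : (A `&` B) x.1 by []; rewrite AB.
- apply: (ae_eqP _ (cst 1)); first exact: f_integrable.
    by apply/measurable_EFinP; exact: measurable_cst.
  move=> B mB; rewrite -f_integral// marginal//.
  exact: esym (etrans (integral_cst Q mB 1%E) (mul1e _)).
- move=> A mA; rewrite -f_integral//; congr (P _).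
  by apply/seteqP; split => x //= [].
Qed.

Let Z (y : borel Y) : R := encode (fun k => f (code_halfline cU k) y).

Let mZ : measurable_fun setT Z.
Proof. exact: (measurable_rc_encode f_random_content cU). Qed.

Let kern (y : borel Y) : probability (borel U) R := universal_kernel cU (Z y).

Let mkern A : measurable A -> measurable_fun setT (fun y => kern y A).
Proof.
move=> mA.
exact: measurableT_comp (measurable_universal_kernel cU mA) mZ.
Qed.

Let measurable_ysection_borel (S : set (borel (U * Y)%type)) (y : borel Y) :
  measurable S -> measurable (ysection S y : set (borel U)).
Proof.
move=> mS; rewrite ysectionE.
rewrite -[X in measurable X]setTI.
apply: (measurable_pair_borel bU bY _ _ measurableT mS); first exact: measurable_id.
exact: measurable_cst.
Qed.

Lemma rectangleE : @measurable _ (borel (U * Y)%type) =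
  <<s [set C | exists A B, [/\ measurable A, measurable B & C = rectangle A B]] >>.
Proof.
apply/seteqP; split.
  apply: smallest_sub; first exact: smallest_sigma_algebra.
  move=> O oO; rewrite (open_cozeroE (pair_cozero_base bU bY) oO).
  pose G := g_sigma_algebraType
    [set C | exists A B, [/\ measurable A, measurable B & C = @rectangle U Y A B]].
  apply: (@bigcup_measurable _ G) => k _; apply: sub_sigma_algebra.
  pose ij := odflt (0, 0)%N (unpickle k : option (nat * nat)).
  exists (cozero bU ij.1), (cozero bY ij.2); split.
  - by apply: measurable_open; exact: cozero_open.
  - by apply: measurable_open; exact: cozero_open.
  by apply/seteqP; split => x; rewrite /cozero/= lt_min => /andP.
apply: smallest_sub; first exact: smallest_sigma_algebra.
by move=> _ [A [B [mA mB ->]]]; exact: measurable_rectangle.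
Qed.

Theorem disintegration : policy_set Q P.
Proof.
exists (pker_of mkern) => S mS.
(* Measurability of the sections is carried through the induction because the complement and union
   cases integrate them. *)
suff [] : measurable_fun setT (fun y => kern y (ysection S y)) /\
  P S = (\int[Q]_y kern y (ysection S y))%E by [].
apply: (@dynkin_induction _ (borel (U * Y)%type) _
  (fun S => measurable_fun setT (fun y => kern y (ysection S y)) /\
    P S = (\int[Q]_y kern y (ysection S y))%E) rectangleE).
- move=> _ _ [A [B [mA mB ->]]] [A' [B' [mA' mB' ->]]].
  exists (A `&` A'), (B `&` B'); split; [exact: measurableI..|].
  by apply/seteqP; split => x /= [[? ?] [? ?]].
- have E : (fun y => kern y (ysection setT y)) = cst 1%E.
    apply/funext => y; rewrite (_ : ysection _ _ = setT) ?probability_setT//.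
    by rewrite ysectionE.
  split; first by rewrite E; exact: measurable_cst.
  rewrite E probability_setT; apply/esym/(etrans (integral_cst Q measurableT 1%E)).
  by rewrite mul1e; exact: probability_setT.
- move=> _ [A [B [mA mB ->]]].
  have E : (fun y => kern y (ysection (rectangle A B) y)) =
      (fun y => kern y A) \_ B.
    apply/funext => y; rewrite patchE; case: ifPn => By.
      by rewrite /rectangle in_ysectionX.
    by rewrite /rectangle notin_ysectionX// measure0.
  split.
    rewrite E; apply/(measurable_restrictT _ mB); apply: measurable_funTS.
    exact: mkern.
  rewrite E -integral_mkcond f_integral//; apply: ae_eq_integral => //.
  + by apply: measurable_funTS; apply/measurable_EFinP; exact: (mf mA).
  + by apply: measurable_funTS; exact: mkern.
  apply: filterS (rc_universal_kernel f_random_content cU mA) => y h _.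
  by rewrite -h.
- move=> C mC [mCk PC].
  have E y : kern y (ysection (~` C) y) = (1 - kern y (ysection C y))%E.
    rewrite -probability_setC; last exact: measurable_ysection_borel.
    by rewrite !ysectionE.
  have mCk' : measurable_fun setT (fun y => kern y (ysection (~` C) y)).
    under eq_fun do rewrite E.
    by apply: emeasurable_funB => //; exact: measurable_cst.
  split => //.
  have fC : P C \is a fin_num by exact: fin_num_measure.
  (* Adding P C to the other side keeps every integrand nonnegative, which avoids integrals of
     differences. *)
  suff h : (\int[Q]_y kern y (ysection (~` C) y) + P C = 1)%E.
    by rewrite probability_setC// -h addeK.
  rewrite PC -ge0_integralD//.
  rewrite -(probability_setT Q) -[RHS]mul1e -integral_cst//.
  apply: eq_integral => y _; rewrite E subeK//.
  by rewrite fin_num_measure//; exact: measurable_ysection_borel.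
- move=> F mF tF /all_and2[mFk PF].
  have E y : kern y (ysection (\bigcup_k F k) y) =
      (\sum_(0 <= k <oo) kern y (ysection (F k) y))%E.
    rewrite ysection_bigcup measure_semi_bigcup//.
    + by move=> k; exact: measurable_ysection_borel.
    + exact: trivIset_ysection.
    + by apply: bigcup_measurable => k _; exact: measurable_ysection_borel.
  split.
    by under eq_fun do rewrite E; exact: ge0_emeasurable_sum.
  under eq_integral do rewrite E.
  rewrite integral_nneseries// measure_semi_bigcup//; last exact: bigcup_measurable.
  by apply: eq_eseriesr => k _; exact: PF.
- by rewrite -rectangleE.
Qed.

End disintegration.

(** * Coding policies *)

Section policy_codings.
Context {R : realType} (U Y : ptopologicalType).
Variables (bU : cozero_base R U) (bY : cozero_base R Y).
Variables (cU : coding R (borel U)) (cY : coding R (borel Y)).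
Hypothesis cUK : forall u, uncode cU (code cU u) = u.
Hypothesis cYK : forall y, uncode cY (code cY y) = y.
Variable Q : probability (borel Y) R.

Local Notation T := (U * Y)%type.
Local Notation bT := (pair_cozero_base bU bY).
Local Notation cT := (pair_coding bU bY cUK cYK).

(** A weakly open set sees a measure only through strict lower bounds on Borel sets. *)
Lemma open_indistinguishable (O : set (prob R T)) (mu nu : prob R T) :
  open O ->
  (forall A, measurable A ->
    (mu : probability (borel T) R) A = (nu : probability (borel T) R) A) ->
  O mu -> O nu.
Proof.
move=> oO munu Omu; have [l lmu lO] := weak_basic_refine bT oO Omu.
apply: lO => sq sql; have := lmu sq sql; rewrite munu//.
exact: measurable_cozeros.
Qed.

(** The sets that do not separate two given points form a sigma-algebra. *)
Lemma borel_indistinguishable (X : ptopologicalType) (x y : X) :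
  (forall O : set X, open O -> O x <-> O y) ->
  forall A : set (borel X), measurable A -> A x <-> A y.
Proof.
move=> xy A; move: A; apply: smallest_sub; last by move=> B oB; exact: xy.
split => [//|A Axy|F Fxy].
  by split => -[_ nA]; split => // /Axy.
by split => -[k _ Fk]; exists k => //; apply/Fxy.
Qed.

Lemma policy_marginal (P : probability (borel T) R) (B : set (borel Y)) :
  policy_set Q P -> measurable B -> P (rectangle setT B) = Q B.
Proof.
move=> [Pi PiE] mB; rewrite PiE; last exact: measurable_rectangle.
rewrite -[RHS]mul1e -[RHS](integral_cst Q mB 1%E) [RHS]integral_mkcond.
apply: eq_integral => y _; rewrite patchE /rectangle; case: ifPn => By.
  by rewrite in_ysectionX//; exact: prob_kernel.
by rewrite notin_ysectionX// measure0.
Qed.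

(** Countably many equations decide the second marginal, so being the code of a policy is a
    measurable condition. *)
Lemma marginal_halfline (P : probability (borel T) R) :
  (forall k, P (rectangle setT (code_halfline cY k)) = Q (code_halfline cY k)) ->
  forall B, measurable B -> P (rectangle setT B) = Q B.
Proof.
have rE B : rectangle setT B = snd @^-1` B :> set (borel T).
  by apply/seteqP; split => x; [case|].
move=> PQ B mB; rewrite rE -(preimage_codeK cY mB).
pose mc := measurableT_comp (measurable_code cY) (@measurable_snd_borel U Y).
apply: (probability_uniqueness (P := law P mc) (Q := law Q (measurable_code cY))
  halflineER halflineI).
  by move=> _ [k _ <-]; have := PQ k; rewrite rE.
by rewrite -[X in measurable X]setTI; exact: measurable_uncode.
Qed.

Let policy_measure (g : policy U Q) : probability (borel T) R := val g.

Let policy_code (g : borel (policy U Q)) : R :=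
  encode (fun k => fine (policy_measure g (code_halfline cT k))).

Let has_marginal (z : R) := forall B, measurable B ->
  universal_kernel cT z (rectangle setT B) = Q B.

(** A real is decoded through the universal kernel; [disintegration] certifies the result as a
    policy once its marginal is right, and all other reals go to the base point. *)
Let policy_uncode (z : R) : borel (policy U Q) :=
  if pselect (has_marginal z) is left h
  then exist (fun P => P \in @policy_set R U Y Q) _
    (mem_set (disintegration bU bY cU h)) : policy U Q
  else point.

Let measurable_policy_eval A : measurable A ->
  measurable_fun setT (fun g : borel (policy U Q) => policy_measure g A).
Proof.
move=> mA; apply: (measurableT_comp (measurable_prob_eval bT mA)).
apply: (@measurable_continuous (policy U Q) (prob R T)).
exact: initial_continuous.
Qed.

Let measurable_policy_code : measurable_fun setT policy_code.
Proof.
apply: measurable_encode => k; apply: measurableT_comp; first exact: fine_measurable.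
by apply: measurable_policy_eval; exact: measurable_code_halfline.
Qed.

Let measurable_has_marginal : measurable [set z | has_marginal z].
Proof.
rewrite (_ : [set _ | _] = \bigcap_k
    [set z | universal_kernel cT z (rectangle setT (code_halfline cY k)) =
             Q (code_halfline cY k)]); last first.
  apply/seteqP; split => z /= h; last by apply: marginal_halfline => k; exact: h.
  by move=> k _; apply: h; exact: measurable_code_halfline.
apply: bigcapT_measurable => k; rewrite -[X in measurable X]setTI.
apply: (measurable_universal_kernel cT _ measurableT (emeasurable_set1 _)).
by apply: measurable_rectangle => //; exact: measurable_code_halfline.
Qed.

Let measurable_policy_uncode : measurable_fun setT policy_uncode.
Proof.
apply: measurable_fun_open => _ [B oB <-].
pose F z : prob R T := universal_kernel cT z.
have mF : measurable (F @^-1` B).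
  apply: (measurable_fun_weak bT) => // A mA.
  exact: measurable_universal_kernel.
have [p|p] := pselect (B (val (point : policy U Q))).
  rewrite (_ : _ @^-1` _ = ([set z | has_marginal z] `&` F @^-1` B) `|`
    ~` [set z | has_marginal z]).
    by apply: measurableU; [exact: measurableI|exact: measurableC].
  apply/seteqP; split => z; rewrite /preimage/= /policy_uncode.
    by case: pselect => [h /= w|h _]; [left|right].
  by case: pselect => [h /= [[_ w]|nV]|h _].
rewrite (_ : _ @^-1` _ = [set z | has_marginal z] `&` F @^-1` B).
  exact: measurableI.
apply/seteqP; split => z; rewrite /preimage/= /policy_uncode.
  by case: pselect => [h /= w|h].
by case: pselect => [h /= [_ w]|h []].
Qed.

(** Decoding yields a measure equal to [g] on measurable sets, perhaps not as a set function; weakly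
    open sets, hence Borel sets, cannot tell the two apart. *)
Let policy_codeK A g : measurable A ->
  A (policy_uncode (policy_code g)) <-> A g.
Proof.
have kE B : measurable B ->
    universal_kernel cT (policy_code g) B = policy_measure g B.
  exact: universal_kernelE.
rewrite /policy_uncode; case: pselect => [h|[]]; last first.
  move=> B mB; rewrite kE; last exact: measurable_rectangle.
  by apply: policy_marginal => //; exact: set_valP.
apply: borel_indistinguishable => _ [B oB <-]; split.
  by apply: open_indistinguishable => // C mC; exact: kE.
by apply: open_indistinguishable => // C mC; exact/esym/kE.
Qed.

Definition policy_coding : coding R (borel (policy U Q)) :=
  Coding measurable_policy_code measurable_policy_uncode policy_codeK.

End policy_codings.

(** * Exchangeable policy profiles *)

Section policy_profiles.
Context {R : realType} (U Y : ptopologicalType).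
Variable Q : probability (borel Y) R.
Variable c : coding R (borel (policy U Q)).
Variable P : randomized_policy U Q.
Hypothesis exP : L_EX U Q P.

Let xi (i : nat) (g : borel (policy_profile U Q)) : borel (policy U Q) :=
  (g : policy_profile U Q) i.

Let mxi i : measurable_fun setT (xi i).
Proof.
apply: (@measurable_continuous (policy_profile U Q) (policy U Q)).
exact: (@proj_continuous nat (fun=> policy U Q) i).
Qed.

Let exch : forall N (s : 'S_N) (A : 'I_N -> set (borel (policy U Q))),
  (forall i, measurable (A i)) ->
  P [set g | forall i : 'I_N, A i (xi i g)] =
  P [set g | forall i : 'I_N, A i (xi (s i) g)].
Proof. by move=> N s A mA; exact: exP. Qed.

Let Z (g : borel (policy_profile U Q)) : borel (unit_interval R) :=
  exist (fun x => x \in `[0, 1]%classic) (directing_code xi c g)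
    (mem_set (encode_itv _)) : unit_interval R.

Let mZ : measurable_fun setT Z.
Proof.
apply: measurable_fun_open => _ [B oB <-].
rewrite -[X in measurable X]setTI.
apply: (measurable_directing_code mxi exch c) => //.
exact: open_measurable.
Qed.

Let val_unit (z : borel (unit_interval R)) : R := val (z : unit_interval R).

Let kern (z : borel (unit_interval R)) : probability (borel (policy U Q)) R :=
  universal_kernel c (val_unit z).

Let mkern A : measurable A -> measurable_fun setT (fun z => kern z A).
Proof.
move=> mA; apply: (measurableT_comp (measurable_universal_kernel c mA)).
apply: (@continuous_measurable_real R (unit_interval R)).
exact: initial_continuous.
Qed.

(** The coordinates of the profile are the exchangeable sequence, and [Z] is its directing code. The
    integral against [P] in [de_finetti] depends on the profile only through [Z], so a change of
    variables gives the integral against the law of [Z]. *)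
Theorem exchangeable_policy_mixture :
  exists (Z : {RV P >-> borel (unit_interval R)})
    (K : R.-pker (borel (unit_interval R)) ~> (borel (policy U Q))),
    mixture P (distribution P Z) K.
Proof.
exists [the {RV P >-> borel (unit_interval R)} of mfun_Sub (mem_set mZ)].
exists (pker_of mkern) => A mA.
rewrite [LHS](de_finetti mxi exch c mA).
rewrite ge0_integral_pushforward//.
- exact: (measurable_lim_prod_kernel mkern mA).
- by move=> z _; exact: (lim_prod_kernel_ge0 kern mA).
Qed.

End policy_profiles.

Theorem theorem3p2 (R : realType) (n m : nat)
    (U : borel_subset R n) (Y : borel_subset R m)
    (Q : probability (borel (space_of Y)) R) :
  L_EX (space_of U) Q `<=` L_CO_SYM (space_of U) Q
  /\
  (forall P : randomized_policy (space_of U) Q, L_EX (space_of U) Q P ->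
    exists (d : measure_display) (Omega : measurableType d)
      (mu : probability Omega R) (Z : {RV mu >-> borel (unit_interval R)})
      (K : R.-pker (borel (unit_interval R)) ~> (borel (policy (space_of U) Q))),
      mixture P (distribution mu Z) K).
Proof.
pose c := policy_coding (space_cozero_base U) (space_cozero_base Y)
  (space_uncode_code (S := U)) (space_uncode_code (S := Y)) Q.
split=> P /(exchangeable_policy_mixture c)[Z [K ZK]].
  by exists (distribution P Z), K.
by exists _, _, P, Z, K.
Qed.
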